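(* If $\Gamma \vdash M : A$, then for all constructors $C$, if $\Gamma \vdash A = \mathtt{T}(C)$ then $$[\![\Gamma]\!] \vdash [\![M]\!] : \mathtt{T}(\mathtt{TRACE}\ C),$$ where $\Gamma$ is a context that maps all term variables to closed records with fields of base type, $M$ is a plain Links query term in normal form, $[\![M]\!]$ is the self-tracing transformation of $M$, and $[\![\Gamma]\!]$ is the trace context of $\Gamma$ (all defined in the context).
   Context: The language is a typed lambda calculus with intensional type analysis, records, lists, database tables and traces. Everything is up to renaming of bound variables; substitution is capture-avoiding. **Kinds and constructors.** $K ::= \mathit{Type} \mid \mathit{Row} \mid K_1\to K_2$. Constructors $C,D ::= \mathtt{Bool}^* \mid \mathtt{Int}^* \mid \mathtt{String}^* \mid \alpha \mid \lambda\alpha{:}K.C \mid C\,D \mid \mathtt{List}^*C \mid \mathtt{Record}^*S \mid \mathtt{Trace}^*C \mid \mathbf{Typerec}\ C\ (C_B,C_I,C_S,C_L,C_R,C_T)$. Row constructors $S ::= \cdot \mid l:C;S \mid \rho \mid \mathbf{Rmap}\ C\ S$. Type variables of kind $\mathit{Row}$ are written $\rho$; arguments of applications may also be row constructors. Row conventions: labels in a row are pairwise distinct and the order of fields is irrelevant. Kinding $\Gamma\vdash C:K$, $\Gamma \vdash S:\mathit{Row}$: variables, abstraction and application as in the simply typed lambda calculus; base constructors have kind $\mathit{Type}$; $\mathtt{List}^*C,\mathtt{Trace}^*C:\mathit{Type}$ if $C:\mathit{Type}$; $\mathtt{Record}^*S:\mathit{Type}$ if $S:\mathit{Row}$; for any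 kind $K$, $\mathbf{Typerec}\,C\,(C_B,C_I,C_S,C_L,C_R,C_T):K$ if $C:\mathit{Type}$, $C_B,C_I,C_S:K$, $C_L,C_T:\mathit{Type}\to K\to K$ and $C_R:\mathit{Row}\to\mathit{Row}\to K$; $\cdot:\mathit{Row}$; $(l:C;S):\mathit{Row}$ if $C:\mathit{Type}$, $S:\mathit{Row}$; $\mathbf{Rmap}\,C\,S:\mathit{Row}$ if $C:\mathit{Type}\to\mathit{Type}$, $S:\mathit{Row}$. Constructor reduction $\leadsto$ is closed under reduction in any immediate sub(row)constructor and has the rules (with $\vec C=(C_B,C_I,C_S,C_L,C_R,C_T)$): $(\lambda\alpha{:}K.C)\,D\leadsto C[\alpha:=D]$; $\mathbf{Rmap}\,C\,\cdot\leadsto\cdot$; $\mathbf{Rmap}\,C\,(l:D;S)\leadsto(l:C\,D;\mathbf{Rmap}\,C\,S)$; $\mathbf{Typerec}\,\mathtt{Bool}^*\vec C\leadsto C_B$; $\mathbf{Typerec}\,\mathtt{Int}^*\vec C\leadsto C_I$; $\mathbf{Typerec}\,\mathtt{String}^*\vec C\leadsto C_S$; $\mathbf{Typerec}\,(\mathtt{List}^*D)\,\vec C\leadsto C_L\,D\,(\mathbf{Typerec}\,D\,\vec C)$; $\mathbf{Typerec}\,(\mathtt{Record}^*S)\,\vec C\leadsto C_R\,S\,(\mathbf{Rmap}\,(\lambda\alpha.\mathbf{Typerec}\,\alpha\,\vec C)\,S)$; $\mathbf{Typerec}\,(\mathtt{Trace}^*D)\,\vec C\leadsto C_T\,D\,(\mathbf{Typerec}\,D\,\vec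 C)$. Constructor equivalence $\Gamma\vdash C=D:K$ (and likewise for rows) is the least congruent equivalence relation on well-kinded (row) constructors such that $C=D:K$ whenever $C:K$, $D:K$ and $C\leadsto D$, and containing $\eta$: $\lambda\alpha{:}K.C\,\alpha = C$. **Types.** $A,B ::= \mathtt{T}(C)\mid\mathtt{Bool}\mid\mathtt{Int}\mid\mathtt{String}\mid A\to B\mid\mathtt{List}\,A\mid\mathtt{Record}\,R\mid\mathtt{Trace}\,A\mid\forall\alpha{:}K.A$, rows $R::=\cdot\mid l:A;R\mid\mathtt{T}(S)$, with the evident kinding. Type/row equivalence $\Gamma\vdash A=B$ is the least congruent equivalence relation with $\mathtt{T}(C)=\mathtt{T}(D)$ when $C=D:\mathit{Type}$, $\mathtt{T}(S)=\mathtt{T}(S')$ when $S=S':\mathit{Row}$, and $\mathtt{T}(\mathtt{Bool}^* )=\mathtt{Bool}$, $\mathtt{T}(\mathtt{Int}^* )=\mathtt{Int}$, $\mathtt{T}(\mathtt{String}^* )=\mathtt{String}$, $\mathtt{T}(\mathtt{List}^*C)=\mathtt{List}\,\mathtt{T}(C)$, $\mathtt{T}(\mathtt{Record}^*S)=\mathtt{Record}\,\mathtt{T}(S)$, $\mathtt{T}(\mathtt{Trace}^*C)=\mathtt{Trace}\,\mathtt{T}(C)$, $\mathtt{T}(\cdot)=\cdot$, $\mathtt{T}(l:C;S)=(l:\mathtt{T}(C);\mathtt{T}(S))$. We write $[A]$ for $\mathtt{List}\,A$, $\langle R\rangle$ for $\mathtt{Record}\,R$ (likewise for constructors) and often omit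 stars. Base types are $\mathtt{Bool},\mathtt{Int},\mathtt{String}$. Contexts $\Gamma$ list distinct variables $\alpha:K$ and $x:A$ with $A:\mathit{Type}$. **Terms and typing** ($\Gamma\vdash M:A$). Variables, $\lambda x{:}A.M$, application, $\mathbf{if}$ as usual; $\Lambda\alpha{:}K.M:\forall\alpha{:}K.A$ if $\Gamma,\alpha:K\vdash M:A$; $M\,C:A[\alpha:=C]$ if $M:\forall\alpha{:}K.A$, $C:K$; $\mathbf{fix}\,f{:}A.M:A$ if $\Gamma,f:A\vdash M:A$; constants $c$ have their base type; $M+N:\mathtt{Int}$ for $M,N:\mathtt{Int}$; $M==N:\mathtt{Bool}$ for $M,N:A$, $A:\mathit{Type}$; $\langle\rangle:\langle\cdot\rangle$; $\langle l=M;N\rangle:\langle l:A;R\rangle$ if $M:A$, $N:\langle R\rangle$ (and $\langle l_1=M_1,\dots,l_n=M_n\rangle$ abbreviates the iterated extension of $\langle\rangle$); $M.l:A$ if $M:\langle l:A;R\rangle$; $[]:[A]$ if $A:\mathit{Type}$; $[M]:[A]$ if $M:A$; $M\mathbin{+\!\!+}N:[A]$ if $M,N:[A]$; $\mathbf{for}\,(x\leftarrow M)\,N:[B]$ if $M:[A]$ and $\Gamma,x:A\vdash N:[B]$; $\mathbf{table}\ n\ \langle \mathsf{oid}:\mathtt{Int};R\rangle:[\langle\mathsf{oid}:\mathtt{Int};R\rangle]$ where $R$ is a closed row of fields of base types; conversion: $M:A$ if $M:B$ and $\Gamma\vdash A=B$. $\mathbf{rmap}^S\,M\,N:\mathtt{T}(\mathtt{Record}^*(\mathbf{Rmap}\,C\,S))$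 if $M:\forall\alpha{:}\mathit{Type}.\mathtt{T}(\alpha)\to\mathtt{T}(C\,\alpha)$ and $N:\mathtt{T}(\mathtt{Record}^*S)$. $\mathbf{typecase}\ C\ \mathbf{of}\,(M_B,M_I,M_S,\beta.M_L,\rho.M_R,\gamma.M_T):B[\alpha:=C]$ if $C:\mathit{Type}$, $\Gamma,\alpha:\mathit{Type}\vdash B:\mathit{Type}$, $M_B:B[\alpha:=\mathtt{Bool}^*]$, $M_I:B[\alpha:=\mathtt{Int}^*]$, $M_S:B[\alpha:=\mathtt{String}^*]$, $\Gamma,\beta:\mathit{Type}\vdash M_L:B[\alpha:=\mathtt{List}^*\beta]$, $\Gamma,\rho:\mathit{Row}\vdash M_R:B[\alpha:=\mathtt{Record}^*\rho]$, $\Gamma,\gamma:\mathit{Type}\vdash M_T:B[\alpha:=\mathtt{Trace}^*\gamma]$. Trace constructors: $\mathtt{Lit}\,c:\mathtt{Trace}\,O$ if $c:O$, $O$ a base type; $\mathtt{If}\,M:\mathtt{Trace}\,A$ if $M:\langle\mathsf{cond}:\mathtt{Trace\ Bool};\mathsf{out}:\mathtt{Trace}\,A\rangle$; $\mathtt{For}\,C\,M:\mathtt{Trace}\,A$ if $C:\mathit{Type}$ and $M:\langle\mathsf{in}:\mathtt{T}(\mathtt{TRACE}\,C);\mathsf{out}:\mathtt{Trace}\,A\rangle$; $\mathtt{Cell}\,M:\mathtt{Trace}\,A$ if $M:\langle\mathsf{tbl}:\mathtt{String};\mathsf{col}:\mathtt{String};\mathsf{row}:\mathtt{Int};\mathsf{val}:A\rangle$;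 $\mathtt{OpEq}\,C\,M:\mathtt{Trace\ Bool}$ if $C:\mathit{Type}$ and $M:\langle\mathsf{l}:\mathtt{T}(\mathtt{TRACE}\,C);\mathsf{r}:\mathtt{T}(\mathtt{TRACE}\,C)\rangle$; $\mathtt{OpPlus}\,M:\mathtt{Trace\ Int}$ if $M:\langle\mathsf{l}:\mathtt{Trace\ Int};\mathsf{r}:\mathtt{Trace\ Int}\rangle$. $\mathbf{tracecase}\ M\ \mathbf{of}\,(x.M_L,x.M_I,\alpha.x.M_F,x.M_C,\alpha.x.M_E,x.M_P):B$ if $M:\mathtt{Trace}\,A$ and each branch (for $\mathtt{Lit},\mathtt{If},\mathtt{For},\mathtt{Cell},\mathtt{OpEq},\mathtt{OpPlus}$) has type $B$ in $\Gamma$ extended, respectively, by: $x:A$; $x:\langle\mathsf{cond}:\mathtt{Trace\ Bool};\mathsf{out}:\mathtt{Trace}\,A\rangle$; $\alpha:\mathit{Type},x:\langle\mathsf{in}:\mathtt{T}(\mathtt{TRACE}\,\alpha);\mathsf{out}:\mathtt{Trace}\,A\rangle$; $x:\langle\mathsf{tbl}:\mathtt{String};\mathsf{col}:\mathtt{String};\mathsf{row}:\mathtt{Int};\mathsf{val}:A\rangle$; $\alpha:\mathit{Type},x:\langle\mathsf{l}:\mathtt{T}(\mathtt{TRACE}\,\alpha);\mathsf{r}:\mathtt{T}(\mathtt{TRACE}\,\alpha)\rangle$; $x:\langle\mathsf{l}:\mathtt{Trace\ Int};\mathsf{r}:\mathtt{Trace\ Int}\rangle$. **Type functions and value.** $\mathtt{TRACE}=\lambda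 a{:}\mathit{Type}.\mathbf{Typerec}\ a\ (\mathtt{Trace\ Bool},\mathtt{Trace\ Int},\mathtt{Trace\ String},\lambda e\,e'.\mathtt{List}\,e',\lambda r\,r'.\mathtt{Record}\,r',\lambda b\,t.t)$ and $\mathtt{VALUE}=\lambda a{:}\mathit{Type}.\mathbf{Typerec}\ a\ (\mathtt{Bool},\mathtt{Int},\mathtt{String},\lambda \_\,b.\mathtt{List}\,b,\lambda \_\,r.\mathtt{Record}\,r,\lambda c\,\_.c)$. The function $\mathtt{value}$, declared with type $\forall a.\,\mathtt{T}(a)\to\mathtt{T}(\mathtt{VALUE}\ a)$, is $\mathtt{value}=\mathbf{fix}\,(\mathtt{value}:\forall a.\mathtt{T}(a)\to\mathtt{T}(\mathtt{VALUE}\,a)).\Lambda a{:}\mathit{Type}.\ \mathbf{typecase}\ a\ \mathbf{of}$ with branches: $\mathtt{Bool}\Rightarrow\lambda x{:}\mathtt{Bool}.x$; $\mathtt{Int}\Rightarrow\lambda x{:}\mathtt{Int}.x$; $\mathtt{String}\Rightarrow\lambda x{:}\mathtt{String}.x$; $\mathtt{List}\,b\Rightarrow\lambda x{:}\mathtt{List}\,b.\,\mathbf{for}\,(y\leftarrow x)\,[\mathtt{value}\,b\,y]$; $\mathtt{Record}\,r\Rightarrow\lambda x{:}\mathtt{Record}\,r.\,\mathbf{rmap}^r\,\mathtt{value}\,x$; $\mathtt{Trace}\,b\Rightarrow\lambda x{:}\mathtt{Trace}\,b.\,\mathbf{tracecase}\ x\ \mathbf{of}$ with branches $\mathtt{Lit}\,y\Rightarrow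 y$; $\mathtt{If}\,y\Rightarrow\mathtt{value}\,(\mathtt{Trace}\,b)\,y.\mathsf{out}$; $\mathtt{For}\,c\,y\Rightarrow\mathtt{value}\,(\mathtt{Trace}\,b)\,y.\mathsf{out}$; $\mathtt{Cell}\,y\Rightarrow y.\mathsf{val}$; $\mathtt{OpPlus}\,y\Rightarrow\mathtt{value}\,(\mathtt{Trace\ Int})\,y.\mathsf{l}+\mathtt{value}\,(\mathtt{Trace\ Int})\,y.\mathsf{r}$; $\mathtt{OpEq}\,c\,y\Rightarrow\mathtt{value}\,(\mathtt{TRACE}\,c)\,y.\mathsf{l}==\mathtt{value}\,(\mathtt{TRACE}\,c)\,y.\mathsf{r}$. **Plain query terms.** A plain Links query term in normal form is a term of the grammar $M,N::=c\mid x\mid x.l\mid\langle\overline{l=M}\rangle\mid M+N\mid M==N\mid\mathbf{if}\ L\ \mathbf{then}\ M\ \mathbf{else}\ N\mid[]\mid[M]\mid M\mathbin{+\!\!+}N\mid\mathbf{for}\,(x\leftarrow\mathbf{table}\ n\ \langle R\rangle)\,N\mid\mathbf{table}\ n\ \langle R\rangle$, with conditions $L::=x.l\mid M==N$. **Self-tracing transformation** (type-directed; ''$M:\mathtt{T}(C)$'' records the type of the term being transformed): $[\![x]\!]=x$; $[\![c]\!]=\mathtt{Lit}\,c$; $[\![M+N]\!]=\mathtt{OpPlus}\langle\mathsf{l}=[\![M]\!],\mathsf{r}=[\![N]\!]\rangle$; $[\![M==(N:\mathtt{T}(C))]\!]=\mathtt{OpEq}\,C\,\langle\mathsf{l}=[\![M]\!],\mathsf{r}=[\![N]\!]\rangle$;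 $[\![\langle\overline{l=M}\rangle]\!]=\langle\overline{l=[\![M]\!]}\rangle$; $[\![M.l]\!]=[\![M]\!].l$; $[\![[]]\!]=[]$; $[\![[M]]\!]=[[\![M]\!]]$; $[\![M\mathbin{+\!\!+}N]\!]=[\![M]\!]\mathbin{+\!\!+}[\![N]\!]$; $[\![\mathbf{table}\ n\ \langle\overline{l:C}\rangle]\!]=\mathbf{for}\,(y\leftarrow\mathbf{table}\ n\ \langle\overline{l:C}\rangle)\,[\langle\overline{l=\mathtt{Cell}\langle\mathsf{tbl}=n,\mathsf{col}=l,\mathsf{row}=y.\mathsf{oid},\mathsf{val}=y.l\rangle}\rangle]$ (names $n,l$ used as string constants); $[\![\mathbf{for}\,(x\leftarrow M)\,N:\mathtt{T}(C)]\!]=\mathbf{for}\,(x\leftarrow[\![M]\!])\ \mathit{dist}(\mathtt{TRACE}\,C,\ \mathtt{For}\,D\,\langle\mathsf{in}=x,\mathsf{out}=\mathbb H\rangle,\ [\![N]\!])$ where $D$ is the element type constructor of $M$, i.e. $M:\mathtt{T}(\mathtt{List}^*D)$; $[\![\mathbf{if}\ L\ \mathbf{then}\ M\ \mathbf{else}\ N:\mathtt{T}(C)]\!]=\mathbf{if}\ \mathtt{value}\,(\mathtt{Trace\ Bool})\,[\![L]\!]\ \mathbf{then}\ \mathit{dist}(\mathtt{TRACE}\,C,k,[\![M]\!])\ \mathbf{else}\ \mathit{dist}(\mathtt{TRACE}\,C,k,[\![N]\!])$ with $k=\mathtt{If}\langle\mathsf{cond}=[\![L]\!],\mathsf{out}=\mathbb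 H\rangle$. Here $\mathbb H$ is a hole, and $\mathit{dist}$ is the meta-level function defined by recursion on (the computed form of) its first argument: $\mathit{dist}(\langle\overline{l:C}\rangle,k,r)=\langle\overline{l=\mathit{dist}(C,k,r.l)}\rangle$; $\mathit{dist}([C],k,t)=\mathbf{for}\,(x\leftarrow t)\,[\mathit{dist}(C,k,x)]$; $\mathit{dist}(\mathtt{Trace}\,C,k,t)=k[\mathbb H:=t]$. **Trace context.** $[\![\Gamma]\!]$ maps a term variable $x$ to $\mathtt{T}(\mathtt{TRACE}\,C)$ if and only if $\Gamma$ maps $x$ to $A$, where $C$ is the obvious constructor with $\cdot\vdash A=\mathtt{T}(C)$.
   Formalization: The declared type of value is added as a typing rule, since the tracecase rule (one type B for all branches) does not derive it; existence of [[M]] is claimed only for C equivalent to a constructor of base types, List, explicit Record and Trace, as dist may be undefined otherwise. *)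

(* Defs.v *)
From Stdlib Require Export String List ZArith.
Export ListNotations.
Local Open Scope string_scope.

Definition label := string.

Inductive base : Set := BBool | BInt | BString.

Inductive const : Set :=
| KBool (b : bool)
| KInt (z : Z)
| KString (s : string).

Definition const_base (c : const) : base :=
  match c with KBool _ => BBool | KInt _ => BInt | KString _ => BString end.

Inductive kind : Set :=
| KType
| KRow
| KArr (K1 K2 : kind).

(* Bound variables are de Bruijn indices, with separate index spaces for type
   variables (bound in constructors, types and terms) and term variables.

   Constructors and row constructors form one syntactic category, separated by
   kinding: since [K1 -> K2] may have [Row] as [K1], substitution may put any
   constructor of kind [Row] in a row position.  [CBase] stands for the
   starred base types, [CEmpty] for the empty row, [CField l C S] for
   [l : C; S].  The branches of [CTyperec] and of [Typecase] below are in the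
   order Bool, Int, String, List, Record, Trace. *)
Inductive con : Set :=
| CBase (b : base)
| CVar (n : nat)
| CLam (K : kind) (C : con)
| CApp (C D : con)
| CList (C : con)
| CRecord (S : con)
| CTrace (C : con)
| CTyperec (C CB CI CS CL CR CT : con)
| CEmpty
| CField (l : label) (C S : con)
| CRmap (C S : con).

Definition up_ren (xi : nat -> nat) : nat -> nat :=
  fun n => match n with O => O | S m => S (xi m) end.

Fixpoint con_ren (xi : nat -> nat) (C : con) : con :=
  match C with
  | CBase b => CBase b
  | CVar n => CVar (xi n)
  | CLam K C => CLam K (con_ren (up_ren xi) C)
  | CApp C D => CApp (con_ren xi C) (con_ren xi D)
  | CList C => CList (con_ren xi C)
  | CRecord r => CRecord (con_ren xi r)
  | CTrace C => CTrace (con_ren xi C)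
  | CTyperec C CB CI CS CL CR CT =>
      CTyperec (con_ren xi C) (con_ren xi CB) (con_ren xi CI) (con_ren xi CS)
               (con_ren xi CL) (con_ren xi CR) (con_ren xi CT)
  | CEmpty => CEmpty
  | CField l C r => CField l (con_ren xi C) (con_ren xi r)
  | CRmap C r => CRmap (con_ren xi C) (con_ren xi r)
  end.

Definition con_shift : con -> con := con_ren S.

Definition up_sub (s : nat -> con) : nat -> con :=
  fun n => match n with O => CVar O | S m => con_shift (s m) end.

Fixpoint con_sub (s : nat -> con) (C : con) : con :=
  match C with
  | CBase b => CBase b
  | CVar n => s n
  | CLam K C => CLam K (con_sub (up_sub s) C)
  | CApp C D => CApp (con_sub s C) (con_sub s D)
  | CList C => CList (con_sub s C)
  | CRecord r => CRecord (con_sub s r)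
  | CTrace C => CTrace (con_sub s C)
  | CTyperec C CB CI CS CL CR CT =>
      CTyperec (con_sub s C) (con_sub s CB) (con_sub s CI) (con_sub s CS)
               (con_sub s CL) (con_sub s CR) (con_sub s CT)
  | CEmpty => CEmpty
  | CField l C r => CField l (con_sub s C) (con_sub s r)
  | CRmap C r => CRmap (con_sub s C) (con_sub s r)
  end.

(* [inst D] maps variable 0 to [D] and lowers the others; [inst_keep D] maps
   variable 0 to [D] and leaves the others in place, so that [D] may use a
   variable 0 that replaces the old one. *)
Definition inst (D : con) : nat -> con :=
  fun n => match n with O => D | S m => CVar m end.
Definition inst_keep (D : con) : nat -> con :=
  fun n => match n with O => D | S m => CVar (S m) end.

(* The labels that occur in a row, not counting those hidden behind a row
   variable or a redex. *)
Fixpoint con_labels (S : con) : list label :=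
  match S with
  | CField l _ r => l :: con_labels r
  | CRmap _ r => con_labels r
  | _ => nil
  end.

(* The convention that labels in a row are pairwise distinct is imposed by the
   freshness premise of [k_field]. *)
Inductive kinding (Delta : list kind) : con -> kind -> Prop :=
| k_base b : kinding Delta (CBase b) KType
| k_var n K : nth_error Delta n = Some K -> kinding Delta (CVar n) K
| k_lam K1 K2 C :
    kinding (K1 :: Delta) C K2 -> kinding Delta (CLam K1 C) (KArr K1 K2)
| k_app K1 K2 C D :
    kinding Delta C (KArr K1 K2) -> kinding Delta D K1 ->
    kinding Delta (CApp C D) K2
| k_list C : kinding Delta C KType -> kinding Delta (CList C) KType
| k_record S : kinding Delta S KRow -> kinding Delta (CRecord S) KType
| k_trace C : kinding Delta C KType -> kinding Delta (CTrace C) KType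
| k_typerec K C CB CI CS CL CR CT :
    kinding Delta C KType ->
    kinding Delta CB K -> kinding Delta CI K -> kinding Delta CS K ->
    kinding Delta CL (KArr KType (KArr K K)) ->
    kinding Delta CR (KArr KRow (KArr KRow K)) ->
    kinding Delta CT (KArr KType (KArr K K)) ->
    kinding Delta (CTyperec C CB CI CS CL CR CT) K
| k_empty : kinding Delta CEmpty KRow
| k_field l C S :
    kinding Delta C KType -> kinding Delta S KRow ->
    ~ In l (con_labels S) ->
    kinding Delta (CField l C S) KRow
| k_rmap C S :
    kinding Delta C (KArr KType KType) -> kinding Delta S KRow ->
    kinding Delta (CRmap C S) KRow.

Inductive cstep : con -> con -> Prop :=
| s_beta K C D : cstep (CApp (CLam K C) D) (con_sub (inst D) C)
| s_rmap_empty C : cstep (CRmap C CEmpty) CEmpty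
| s_rmap_field C l D S :
    cstep (CRmap C (CField l D S)) (CField l (CApp C D) (CRmap C S))
| s_rec_bool CB CI CS CL CR CT :
    cstep (CTyperec (CBase BBool) CB CI CS CL CR CT) CB
| s_rec_int CB CI CS CL CR CT :
    cstep (CTyperec (CBase BInt) CB CI CS CL CR CT) CI
| s_rec_string CB CI CS CL CR CT :
    cstep (CTyperec (CBase BString) CB CI CS CL CR CT) CS
| s_rec_list D CB CI CS CL CR CT :
    cstep (CTyperec (CList D) CB CI CS CL CR CT)
          (CApp (CApp CL D) (CTyperec D CB CI CS CL CR CT))
| s_rec_record S CB CI CS CL CR CT :
    cstep (CTyperec (CRecord S) CB CI CS CL CR CT)
          (CApp (CApp CR S)
             (CRmap
                (CLam KType
                   (CTyperec (CVar 0) (con_shift CB) (con_shift CI)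
                      (con_shift CS) (con_shift CL) (con_shift CR)
                      (con_shift CT)))
                S))
| s_rec_trace D CB CI CS CL CR CT :
    cstep (CTyperec (CTrace D) CB CI CS CL CR CT)
          (CApp (CApp CT D) (CTyperec D CB CI CS CL CR CT))
| s_lam K C C' : cstep C C' -> cstep (CLam K C) (CLam K C')
| s_app1 C C' D : cstep C C' -> cstep (CApp C D) (CApp C' D)
| s_app2 C D D' : cstep D D' -> cstep (CApp C D) (CApp C D')
| s_list C C' : cstep C C' -> cstep (CList C) (CList C')
| s_record S S' : cstep S S' -> cstep (CRecord S) (CRecord S')
| s_trace C C' : cstep C C' -> cstep (CTrace C) (CTrace C')
| s_rec C C' CB CI CS CL CR CT :
    cstep C C' ->
    cstep (CTyperec C CB CI CS CL CR CT) (CTyperec C' CB CI CS CL CR CT)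
| s_recB C CB CB' CI CS CL CR CT :
    cstep CB CB' ->
    cstep (CTyperec C CB CI CS CL CR CT) (CTyperec C CB' CI CS CL CR CT)
| s_recI C CB CI CI' CS CL CR CT :
    cstep CI CI' ->
    cstep (CTyperec C CB CI CS CL CR CT) (CTyperec C CB CI' CS CL CR CT)
| s_recS C CB CI CS CS' CL CR CT :
    cstep CS CS' ->
    cstep (CTyperec C CB CI CS CL CR CT) (CTyperec C CB CI CS' CL CR CT)
| s_recL C CB CI CS CL CL' CR CT :
    cstep CL CL' ->
    cstep (CTyperec C CB CI CS CL CR CT) (CTyperec C CB CI CS CL' CR CT)
| s_recR C CB CI CS CL CR CR' CT :
    cstep CR CR' ->
    cstep (CTyperec C CB CI CS CL CR CT) (CTyperec C CB CI CS CL CR' CT)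
| s_recT C CB CI CS CL CR CT CT' :
    cstep CT CT' ->
    cstep (CTyperec C CB CI CS CL CR CT) (CTyperec C CB CI CS CL CR CT')
| s_field1 l C C' S : cstep C C' -> cstep (CField l C S) (CField l C' S)
| s_field2 l C S S' : cstep S S' -> cstep (CField l C S) (CField l C S')
| s_rmap1 C C' S : cstep C C' -> cstep (CRmap C S) (CRmap C' S)
| s_rmap2 C S S' : cstep S S' -> cstep (CRmap C S) (CRmap C S').

(* Relates well-kinded constructors only.  [ce_swap] expresses that the order
   of the fields of a row is irrelevant. *)
Inductive ceq (Delta : list kind) : con -> con -> kind -> Prop :=
| ce_refl C K : kinding Delta C K -> ceq Delta C C K
| ce_sym C D K : ceq Delta C D K -> ceq Delta D C K
| ce_trans C D E K : ceq Delta C D K -> ceq Delta D E K -> ceq Delta C E K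
| ce_step C D K :
    kinding Delta C K -> kinding Delta D K -> cstep C D -> ceq Delta C D K
| ce_eta C K1 K2 :
    kinding Delta C (KArr K1 K2) ->
    ceq Delta (CLam K1 (CApp (con_shift C) (CVar 0))) C (KArr K1 K2)
| ce_swap l1 C1 l2 C2 S :
    kinding Delta (CField l1 C1 (CField l2 C2 S)) KRow ->
    ceq Delta (CField l1 C1 (CField l2 C2 S))
              (CField l2 C2 (CField l1 C1 S)) KRow
| ce_lam K1 K2 C C' :
    ceq (K1 :: Delta) C C' K2 ->
    ceq Delta (CLam K1 C) (CLam K1 C') (KArr K1 K2)
| ce_app K1 K2 C C' D D' :
    ceq Delta C C' (KArr K1 K2) -> ceq Delta D D' K1 ->
    ceq Delta (CApp C D) (CApp C' D') K2
| ce_list C C' : ceq Delta C C' KType -> ceq Delta (CList C) (CList C') KType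
| ce_record S S' :
    ceq Delta S S' KRow -> ceq Delta (CRecord S) (CRecord S') KType
| ce_trace C C' :
    ceq Delta C C' KType -> ceq Delta (CTrace C) (CTrace C') KType
| ce_typerec K C C' CB CB' CI CI' CS CS' CL CL' CR CR' CT CT' :
    ceq Delta C C' KType ->
    ceq Delta CB CB' K -> ceq Delta CI CI' K -> ceq Delta CS CS' K ->
    ceq Delta CL CL' (KArr KType (KArr K K)) ->
    ceq Delta CR CR' (KArr KRow (KArr KRow K)) ->
    ceq Delta CT CT' (KArr KType (KArr K K)) ->
    ceq Delta (CTyperec C CB CI CS CL CR CT)
              (CTyperec C' CB' CI' CS' CL' CR' CT') K
| ce_field l C C' S S' :
    ceq Delta C C' KType -> ceq Delta S S' KRow ->
    ~ In l (con_labels S) -> ~ In l (con_labels S') ->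
    ceq Delta (CField l C S) (CField l C' S') KRow
| ce_rmap C C' S S' :
    ceq Delta C C' (KArr KType KType) -> ceq Delta S S' KRow ->
    ceq Delta (CRmap C S) (CRmap C' S') KRow.

Inductive ty : Set :=
| TT (C : con)
| TBase (b : base)
| TArr (A B : ty)
| TList (A : ty)
| TRecord (R : row)
| TTrace (A : ty)
| TAll (K : kind) (A : ty)
with row : Set :=
| REmpty
| RField (l : label) (A : ty) (R : row)
| RT (S : con).

Fixpoint ty_ren (xi : nat -> nat) (A : ty) : ty :=
  match A with
  | TT C => TT (con_ren xi C)
  | TBase b => TBase b
  | TArr A B => TArr (ty_ren xi A) (ty_ren xi B)
  | TList A => TList (ty_ren xi A)
  | TRecord R => TRecord (row_ren xi R)
  | TTrace A => TTrace (ty_ren xi A)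
  | TAll K A => TAll K (ty_ren (up_ren xi) A)
  end
with row_ren (xi : nat -> nat) (R : row) : row :=
  match R with
  | REmpty => REmpty
  | RField l A R => RField l (ty_ren xi A) (row_ren xi R)
  | RT r => RT (con_ren xi r)
  end.

Definition ty_shift : ty -> ty := ty_ren S.

Fixpoint ty_sub (s : nat -> con) (A : ty) : ty :=
  match A with
  | TT C => TT (con_sub s C)
  | TBase b => TBase b
  | TArr A B => TArr (ty_sub s A) (ty_sub s B)
  | TList A => TList (ty_sub s A)
  | TRecord R => TRecord (row_sub s R)
  | TTrace A => TTrace (ty_sub s A)
  | TAll K A => TAll K (ty_sub (up_sub s) A)
  end
with row_sub (s : nat -> con) (R : row) : row :=
  match R with
  | REmpty => REmpty
  | RField l A R => RField l (ty_sub s A) (row_sub s R)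
  | RT r => RT (con_sub s r)
  end.

Fixpoint row_labels (R : row) : list label :=
  match R with
  | REmpty => nil
  | RField l _ R' => l :: row_labels R'
  | RT r => con_labels r
  end.

Inductive ty_wf : list kind -> ty -> Prop :=
| w_T Delta C : kinding Delta C KType -> ty_wf Delta (TT C)
| w_base Delta b : ty_wf Delta (TBase b)
| w_arr Delta A B : ty_wf Delta A -> ty_wf Delta B -> ty_wf Delta (TArr A B)
| w_list Delta A : ty_wf Delta A -> ty_wf Delta (TList A)
| w_record Delta R : row_wf Delta R -> ty_wf Delta (TRecord R)
| w_trace Delta A : ty_wf Delta A -> ty_wf Delta (TTrace A)
| w_all Delta K A : ty_wf (K :: Delta) A -> ty_wf Delta (TAll K A)
with row_wf : list kind -> row -> Prop :=
| w_empty Delta : row_wf Delta REmpty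
| w_field Delta l A R :
    ty_wf Delta A -> row_wf Delta R -> ~ In l (row_labels R) ->
    row_wf Delta (RField l A R)
| w_RT Delta S : kinding Delta S KRow -> row_wf Delta (RT S).

Inductive teq : list kind -> ty -> ty -> Prop :=
| te_refl Delta A : ty_wf Delta A -> teq Delta A A
| te_sym Delta A B : teq Delta A B -> teq Delta B A
| te_trans Delta A B C : teq Delta A B -> teq Delta B C -> teq Delta A C
| te_T Delta C D : ceq Delta C D KType -> teq Delta (TT C) (TT D)
| te_arr Delta A A' B B' :
    teq Delta A A' -> teq Delta B B' -> teq Delta (TArr A B) (TArr A' B')
| te_list Delta A A' : teq Delta A A' -> teq Delta (TList A) (TList A')
| te_record Delta R R' :
    req Delta R R' -> teq Delta (TRecord R) (TRecord R')
| te_trace Delta A A' : teq Delta A A' -> teq Delta (TTrace A) (TTrace A')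
| te_all Delta K A A' :
    teq (K :: Delta) A A' -> teq Delta (TAll K A) (TAll K A')
| te_T_base Delta b : teq Delta (TT (CBase b)) (TBase b)
| te_T_list Delta C :
    kinding Delta C KType -> teq Delta (TT (CList C)) (TList (TT C))
| te_T_record Delta S :
    kinding Delta S KRow -> teq Delta (TT (CRecord S)) (TRecord (RT S))
| te_T_trace Delta C :
    kinding Delta C KType -> teq Delta (TT (CTrace C)) (TTrace (TT C))
with req : list kind -> row -> row -> Prop :=
| re_refl Delta R : row_wf Delta R -> req Delta R R
| re_sym Delta R R' : req Delta R R' -> req Delta R' R
| re_trans Delta R R' R'' :
    req Delta R R' -> req Delta R' R'' -> req Delta R R''
| re_field Delta l A A' R R' :
    teq Delta A A' -> req Delta R R' ->
    ~ In l (row_labels R) -> ~ In l (row_labels R') ->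
    req Delta (RField l A R) (RField l A' R')
| re_swap Delta l1 A1 l2 A2 R :
    row_wf Delta (RField l1 A1 (RField l2 A2 R)) ->
    req Delta (RField l1 A1 (RField l2 A2 R))
              (RField l2 A2 (RField l1 A1 R))
| re_T Delta S S' : ceq Delta S S' KRow -> req Delta (RT S) (RT S')
| re_T_empty Delta : req Delta (RT CEmpty) REmpty
| re_T_field Delta l C S :
    kinding Delta (CField l C S) KRow ->
    req Delta (RT (CField l C S)) (RField l (TT C) (RT S)).

(* [Table n R] is the table named [n] whose fields are [oid : Int] followed by
   [R].  [ML], [MR] and [MT] of [Typecase] bind one type variable each; the
   branches of [Tracecase] are for Lit, If, For, Cell, OpEq, OpPlus, and all
   bind a term variable, those for For and OpEq a type variable as well.
   [RecExt l M N] extends the record [N] with [l = M]. *)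
Inductive tm : Set :=
| Var (n : nat)
| Const (c : const)
| Lam (A : ty) (M : tm)
| App (M N : tm)
| TLam (K : kind) (M : tm)
| TApp (M : tm) (C : con)
| Fix (A : ty) (M : tm)
| If (L M N : tm)
| Plus (M N : tm)
| Equal (M N : tm)
| RecNil
| RecExt (l : label) (M N : tm)
| Proj (M : tm) (l : label)
| Nil
| Single (M : tm)
| Append (M N : tm)
| For (M N : tm)
| Table (n : string) (R : list (label * base))
| Rmap (S : con) (M N : tm)
| Typecase (C : con) (MB MI MS ML MR MT : tm)
| TrLit (c : const)
| TrIf (M : tm)
| TrFor (C : con) (M : tm)
| TrCell (M : tm)
| TrOpEq (C : con) (M : tm)
| TrOpPlus (M : tm)
| Tracecase (M ML MI MF MC ME MP : tm).

(* Renaming of term variables only. *)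
Fixpoint tm_ren (xi : nat -> nat) (M : tm) : tm :=
  match M with
  | Var n => Var (xi n)
  | Const c => Const c
  | Lam A M => Lam A (tm_ren (up_ren xi) M)
  | App M N => App (tm_ren xi M) (tm_ren xi N)
  | TLam K M => TLam K (tm_ren xi M)
  | TApp M C => TApp (tm_ren xi M) C
  | Fix A M => Fix A (tm_ren (up_ren xi) M)
  | If L M N => If (tm_ren xi L) (tm_ren xi M) (tm_ren xi N)
  | Plus M N => Plus (tm_ren xi M) (tm_ren xi N)
  | Equal M N => Equal (tm_ren xi M) (tm_ren xi N)
  | RecNil => RecNil
  | RecExt l M N => RecExt l (tm_ren xi M) (tm_ren xi N)
  | Proj M l => Proj (tm_ren xi M) l
  | Nil => Nil
  | Single M => Single (tm_ren xi M)
  | Append M N => Append (tm_ren xi M) (tm_ren xi N)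
  | For M N => For (tm_ren xi M) (tm_ren (up_ren xi) N)
  | Table n R => Table n R
  | Rmap r M N => Rmap r (tm_ren xi M) (tm_ren xi N)
  | Typecase C MB MI MS ML MR MT =>
      Typecase C (tm_ren xi MB) (tm_ren xi MI) (tm_ren xi MS)
                 (tm_ren xi ML) (tm_ren xi MR) (tm_ren xi MT)
  | TrLit c => TrLit c
  | TrIf M => TrIf (tm_ren xi M)
  | TrFor C M => TrFor C (tm_ren xi M)
  | TrCell M => TrCell (tm_ren xi M)
  | TrOpEq C M => TrOpEq C (tm_ren xi M)
  | TrOpPlus M => TrOpPlus (tm_ren xi M)
  | Tracecase M ML MI MF MC ME MP =>
      Tracecase (tm_ren xi M) (tm_ren (up_ren xi) ML) (tm_ren (up_ren xi) MI)
        (tm_ren (up_ren xi) MF) (tm_ren (up_ren xi) MC)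
        (tm_ren (up_ren xi) ME) (tm_ren (up_ren xi) MP)
  end.

Definition tm_shift : tm -> tm := tm_ren S.

Definition record_tm (fs : list (label * tm)) : tm :=
  fold_right (fun f N => RecExt (fst f) (snd f) N) RecNil fs.
Definition record_row (fs : list (label * ty)) : row :=
  fold_right (fun f R => RField (fst f) (snd f) R) REmpty fs.
Definition base_row (fs : list (label * base)) : row :=
  fold_right (fun f R => RField (fst f) (TBase (snd f)) R) REmpty fs.
Definition base_con_row (fs : list (label * base)) : con :=
  fold_right (fun f S => CField (fst f) (CBase (snd f)) S) CEmpty fs.

Definition table_fields (R : list (label * base)) : list (label * base) :=
  ("oid", BInt) :: R.

Definition TRACE : con :=
  CLam KType
    (CTyperec (CVar 0)
       (CTrace (CBase BBool)) (CTrace (CBase BInt)) (CTrace (CBase BString))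
       (CLam KType (CLam KType (CList (CVar 0))))
       (CLam KRow (CLam KRow (CRecord (CVar 0))))
       (CLam KType (CLam KType (CVar 0)))).

Definition VALUE : con :=
  CLam KType
    (CTyperec (CVar 0)
       (CBase BBool) (CBase BInt) (CBase BString)
       (CLam KType (CLam KType (CList (CVar 0))))
       (CLam KRow (CLam KRow (CRecord (CVar 0))))
       (CLam KType (CLam KType (CVar 1)))).

Definition value_ty : ty :=
  TAll KType (TArr (TT (CVar 0)) (TT (CApp VALUE (CVar 0)))).

Definition value : tm :=
  Fix value_ty
    (TLam KType
       (Typecase (CVar 0)
          (Lam (TBase BBool) (Var 0))
          (Lam (TBase BInt) (Var 0))
          (Lam (TBase BString) (Var 0))
          (Lam (TList (TT (CVar 0)))
             (For (Var 0) (Single (App (TApp (Var 2) (CVar 0)) (Var 0)))))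
          (Lam (TRecord (RT (CVar 0)))
             (Rmap (CVar 0) (Var 1) (Var 0)))
          (Lam (TTrace (TT (CVar 0)))
             (Tracecase (Var 0)
                (Var 0)
                (App (TApp (Var 2) (CTrace (CVar 0))) (Proj (Var 0) "out"))
                (App (TApp (Var 2) (CTrace (CVar 1))) (Proj (Var 0) "out"))
                (Proj (Var 0) "val")
                (Equal (App (TApp (Var 2) (CApp TRACE (CVar 0)))
                       (Proj (Var 0) "l"))
                    (App (TApp (Var 2) (CApp TRACE (CVar 0)))
                       (Proj (Var 0) "r")))
                (Plus (App (TApp (Var 2) (CTrace (CBase BInt)))
                         (Proj (Var 0) "l"))
                      (App (TApp (Var 2) (CTrace (CBase BInt)))
                         (Proj (Var 0) "r"))))))).

Definition if_row (A : ty) : row :=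
  record_row [("cond", TTrace (TBase BBool));
              ("out", TTrace A)].
Definition for_row (C : con) (A : ty) : row :=
  record_row [("in", TT (CApp TRACE C)); ("out", TTrace A)].
Definition cell_row (A : ty) : row :=
  record_row [("tbl", TBase BString); ("col", TBase BString);
              ("row", TBase BInt); ("val", A)].
Definition opeq_row (C : con) : row :=
  record_row [("l", TT (CApp TRACE C));
              ("r", TT (CApp TRACE C))].
Definition opplus_row : row :=
  record_row [("l", TTrace (TBase BInt));
              ("r", TTrace (TBase BInt))].

(* A context is a pair of a list of kinds [Delta] and a list of types [G] over
   [Delta].  [t_value] gives the recursive function [value] the type it is
   declared with: this does not follow from the other rules, because [t_tracecase]
   wants the branches for OpEq and OpPlus at the type [T(b)] of the other
   branches, not at Bool and Int.  The well-formedness premises on instantiated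
   types in [t_tapp] and [t_typecase] exclude instances that repeat a label in
   a row. *)
Inductive typed : list kind -> list ty -> tm -> ty -> Prop :=
| t_var Delta G x A : nth_error G x = Some A -> typed Delta G (Var x) A
| t_const Delta G c : typed Delta G (Const c) (TBase (const_base c))
| t_lam Delta G A B M :
    ty_wf Delta A -> typed Delta (A :: G) M B ->
    typed Delta G (Lam A M) (TArr A B)
| t_app Delta G A B M N :
    typed Delta G M (TArr A B) -> typed Delta G N A ->
    typed Delta G (App M N) B
| t_tlam Delta G K A M :
    typed (K :: Delta) (map ty_shift G) M A ->
    typed Delta G (TLam K M) (TAll K A)
| t_tapp Delta G K A M C :
    typed Delta G M (TAll K A) -> kinding Delta C K ->
    ty_wf Delta (ty_sub (inst C) A) ->
    typed Delta G (TApp M C) (ty_sub (inst C) A)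
| t_fix Delta G A M :
    ty_wf Delta A -> typed Delta (A :: G) M A -> typed Delta G (Fix A M) A
| t_value Delta G : typed Delta G value value_ty
| t_if Delta G A L M N :
    typed Delta G L (TBase BBool) ->
    typed Delta G M A -> typed Delta G N A ->
    typed Delta G (If L M N) A
| t_plus Delta G M N :
    typed Delta G M (TBase BInt) -> typed Delta G N (TBase BInt) ->
    typed Delta G (Plus M N) (TBase BInt)
| t_eq Delta G A M N :
    ty_wf Delta A -> typed Delta G M A -> typed Delta G N A ->
    typed Delta G (Equal M N) (TBase BBool)
| t_recnil Delta G : typed Delta G RecNil (TRecord REmpty)
| t_recext Delta G l A R M N :
    typed Delta G M A -> typed Delta G N (TRecord R) ->
    row_wf Delta (RField l A R) ->
    typed Delta G (RecExt l M N) (TRecord (RField l A R))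
| t_proj Delta G l A R M :
    typed Delta G M (TRecord (RField l A R)) -> typed Delta G (Proj M l) A
| t_nil Delta G A : ty_wf Delta A -> typed Delta G Nil (TList A)
| t_single Delta G A M :
    typed Delta G M A -> typed Delta G (Single M) (TList A)
| t_append Delta G A M N :
    typed Delta G M (TList A) -> typed Delta G N (TList A) ->
    typed Delta G (Append M N) (TList A)
| t_for Delta G A B M N :
    typed Delta G M (TList A) -> typed Delta (A :: G) N (TList B) ->
    typed Delta G (For M N) (TList B)
| t_table Delta G n R :
    NoDup (map fst (table_fields R)) ->
    typed Delta G (Table n R) (TList (TRecord (base_row (table_fields R))))
| t_conv Delta G A B M :
    typed Delta G M B -> teq Delta A B -> typed Delta G M A
| t_rmap Delta G C S M N :
    kinding Delta C (KArr KType KType) -> kinding Delta S KRow ->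
    typed Delta G M
      (TAll KType (TArr (TT (CVar 0)) (TT (CApp (con_shift C) (CVar 0))))) ->
    typed Delta G N (TT (CRecord S)) ->
    typed Delta G (Rmap S M N) (TT (CRecord (CRmap C S)))
| t_typecase Delta G B C MB MI MS ML MR MT :
    kinding Delta C KType ->
    ty_wf (KType :: Delta) B ->
    typed Delta G MB (ty_sub (inst (CBase BBool)) B) ->
    typed Delta G MI (ty_sub (inst (CBase BInt)) B) ->
    typed Delta G MS (ty_sub (inst (CBase BString)) B) ->
    typed (KType :: Delta) (map ty_shift G) ML
      (ty_sub (inst_keep (CList (CVar 0))) B) ->
    typed (KRow :: Delta) (map ty_shift G) MR
      (ty_sub (inst_keep (CRecord (CVar 0))) B) ->
    typed (KType :: Delta) (map ty_shift G) MT
      (ty_sub (inst_keep (CTrace (CVar 0))) B) ->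
    ty_wf Delta (ty_sub (inst C) B) ->
    typed Delta G (Typecase C MB MI MS ML MR MT) (ty_sub (inst C) B)
| t_trlit Delta G c :
    typed Delta G (TrLit c) (TTrace (TBase (const_base c)))
| t_trif Delta G A M :
    typed Delta G M (TRecord (if_row A)) -> typed Delta G (TrIf M) (TTrace A)
| t_trfor Delta G A C M :
    kinding Delta C KType ->
    typed Delta G M (TRecord (for_row C A)) ->
    typed Delta G (TrFor C M) (TTrace A)
| t_trcell Delta G A M :
    typed Delta G M (TRecord (cell_row A)) ->
    typed Delta G (TrCell M) (TTrace A)
| t_tropeq Delta G C M :
    kinding Delta C KType ->
    typed Delta G M (TRecord (opeq_row C)) ->
    typed Delta G (TrOpEq C M) (TTrace (TBase BBool))
| t_tropplus Delta G M :
    typed Delta G M (TRecord opplus_row) ->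
    typed Delta G (TrOpPlus M) (TTrace (TBase BInt))
| t_tracecase Delta G A B M ML MI MF MC ME MP :
    typed Delta G M (TTrace A) ->
    typed Delta (A :: G) ML B ->
    typed Delta (TRecord (if_row A) :: G) MI B ->
    typed (KType :: Delta)
      (TRecord (for_row (CVar 0) (ty_shift A)) :: map ty_shift G)
      MF (ty_shift B) ->
    typed Delta (TRecord (cell_row A) :: G) MC B ->
    typed (KType :: Delta)
      (TRecord (opeq_row (CVar 0)) :: map ty_shift G) ME (ty_shift B) ->
    typed Delta (TRecord opplus_row :: G) MP B ->
    typed Delta G (Tracecase M ML MI MF MC ME MP) B.

(* Plain query terms in normal form.  The list in [plain_fields] holds the
   labels of the record literal, which are pairwise distinct. *)
Inductive plain : tm -> Prop :=
| p_const c : plain (Const c)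
| p_var x : plain (Var x)
| p_proj x l : plain (Proj (Var x) l)
| p_record ls M : plain_fields ls M -> plain M
| p_plus M N : plain M -> plain N -> plain (Plus M N)
| p_eq M N : plain M -> plain N -> plain (Equal M N)
| p_if L M N : plain_cond L -> plain M -> plain N -> plain (If L M N)
| p_nil : plain Nil
| p_single M : plain M -> plain (Single M)
| p_append M N : plain M -> plain N -> plain (Append M N)
| p_for n R N : plain N -> plain (For (Table n R) N)
| p_table n R : plain (Table n R)
with plain_fields : list label -> tm -> Prop :=
| pf_nil : plain_fields [] RecNil
| pf_cons l ls M N :
    ~ In l ls -> plain M -> plain_fields ls N ->
    plain_fields (l :: ls) (RecExt l M N)
with plain_cond : tm -> Prop :=
| pc_proj x l : plain_cond (Proj (Var x) l)
| pc_eq M N : plain M -> plain N -> plain_cond (Equal M N).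

(* The two trace terms with a hole that the transformation uses:
   [For D <in = M, out = H>] and [If <cond = L, out = H>]. *)
Inductive hole_tm : Set :=
| HFor (D : con) (M : tm)
| HIf (L : tm).

Definition fill (k : hole_tm) (t : tm) : tm :=
  match k with
  | HFor D M => TrFor D (record_tm [("in", M); ("out", t)])
  | HIf L => TrIf (record_tm [("cond", L); ("out", t)])
  end.

Definition hole_shift (k : hole_tm) : hole_tm :=
  match k with
  | HFor D M => HFor D (tm_shift M)
  | HIf L => HIf (tm_shift L)
  end.

(* The first argument is a type in computed form; there is no result if it is
   not.  On a row, the result is the record literal of the distributed fields
   of [t]. *)
Fixpoint dist (C : con) (k : hole_tm) (t : tm) : option tm :=
  match C with
  | CTrace _ => Some (fill k t)
  | CList C' =>
      match dist C' (hole_shift k) (Var 0) with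
      | Some P => Some (For t (Single P))
      | None => None
      end
  | CRecord r => dist r k t
  | CEmpty => Some RecNil
  | CField l C' r =>
      match dist C' k (Proj t l), dist r k t with
      | Some P, Some Q => Some (RecExt l P Q)
      | _, _ => None
      end
  | _ => None
  end.

(* [dist_at Delta C k t P]: [P] is [dist(C, k, t)], where a computed form of
   the constructor [C] is a constructor equivalent to it on which [dist] is
   defined. *)
Definition dist_at (Delta : list kind) (C : con) (k : hole_tm) (t P : tm)
  : Prop :=
  exists F, ceq Delta C F KType /\ dist F k t = Some P.

(* The body of the comprehension that annotates the rows of table [n]; the row
   is variable 0. *)
Definition cell_record (n : string) (fs : list (label * base)) : tm :=
  record_tm
    (map (fun f =>
            (fst f,
             TrCell (record_tm
               [("tbl", Const (KString n));
                ("col", Const (KString (fst f)));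
                ("row", Proj (Var 0) "oid");
                ("val", Proj (Var 0) (fst f))])))
         fs).

(* [trans Delta G M C M'] means that [M'] is the self-tracing transformation of
   [M : T(C)] in the context [Delta; G].  The transformation is type-directed,
   so it is defined along the typing of [M], including conversion; a term with
   several types, such as the empty list, is transformed separately at each. *)
Inductive trans : list kind -> list ty -> tm -> con -> tm -> Prop :=
| tr_var Delta G x A C :
    nth_error G x = Some A -> teq Delta A (TT C) ->
    trans Delta G (Var x) C (Var x)
| tr_const Delta G c :
    trans Delta G (Const c) (CBase (const_base c)) (TrLit c)
| tr_plus Delta G M N M' N' :
    trans Delta G M (CBase BInt) M' -> trans Delta G N (CBase BInt) N' ->
    trans Delta G (Plus M N) (CBase BInt)
      (TrOpPlus (record_tm [("l", M'); ("r", N')]))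
| tr_eq Delta G C M N M' N' :
    trans Delta G M C M' -> trans Delta G N C N' ->
    trans Delta G (Equal M N) (CBase BBool)
      (TrOpEq C (record_tm [("l", M'); ("r", N')]))
| tr_recnil Delta G : trans Delta G RecNil (CRecord CEmpty) RecNil
| tr_recext Delta G l C S M N M' N' :
    trans Delta G M C M' -> trans Delta G N (CRecord S) N' ->
    kinding Delta (CField l C S) KRow ->
    trans Delta G (RecExt l M N) (CRecord (CField l C S)) (RecExt l M' N')
| tr_proj Delta G l C S M M' :
    trans Delta G M (CRecord (CField l C S)) M' ->
    trans Delta G (Proj M l) C (Proj M' l)
| tr_nil Delta G C :
    kinding Delta C KType -> trans Delta G Nil (CList C) Nil
| tr_single Delta G C M M' :
    trans Delta G M C M' -> trans Delta G (Single M) (CList C) (Single M')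
| tr_append Delta G C M N M' N' :
    trans Delta G M (CList C) M' -> trans Delta G N (CList C) N' ->
    trans Delta G (Append M N) (CList C) (Append M' N')
| tr_table Delta G n R :
    NoDup (map fst (table_fields R)) ->
    trans Delta G (Table n R)
      (CList (CRecord (base_con_row (table_fields R))))
      (For (Table n R) (Single (cell_record n (table_fields R))))
| tr_for Delta G C D M N M' N' P :
    trans Delta G M (CList D) M' ->
    trans Delta (TT D :: G) N (CList C) N' ->
    dist_at Delta (CApp TRACE (CList C)) (HFor D (Var 0)) N' P ->
    trans Delta G (For M N) (CList C) (For M' P)
| tr_if Delta G C L M N L' M' N' P Q :
    trans Delta G L (CBase BBool) L' ->
    trans Delta G M C M' -> trans Delta G N C N' ->
    dist_at Delta (CApp TRACE C) (HIf L') M' P ->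
    dist_at Delta (CApp TRACE C) (HIf L') N' Q ->
    trans Delta G (If L M N) C
      (If (App (TApp value (CTrace (CBase BBool))) L') P Q)
| tr_conv Delta G C D M M' :
    trans Delta G M C M' -> ceq Delta C D KType -> trans Delta G M D M'.

Definition base_record (A : ty) : Prop :=
  exists fs, NoDup (map fst fs) /\ teq [] A (TRecord (base_row fs)).

(* Type variables, if any, are the same in a context and its trace context. *)
Definition trace_ctx (G G' : list ty) : Prop :=
  Forall2 (fun A A' =>
             exists C, teq [] A (TT C) /\ A' = TT (CApp TRACE C)) G G'.

(* The types at which the transformation is defined.  On others [dist] may get
   stuck: on a type variable, or on a Typerec over a record that returns a kind
   other than Type and whose reduct is therefore not well-kinded. *)
Inductive ground : con -> Prop :=
| g_base b : ground (CBase b)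
| g_list F : ground F -> ground (CList F)
| g_record S : ground_row S -> ground (CRecord S)
| g_trace F : ground F -> ground (CTrace F)
with ground_row : con -> Prop :=
| g_empty : ground_row CEmpty
| g_field l F S : ground F -> ground_row S -> ground_row (CField l F S).

(* Main.v *)
(* Typing of the transform is by induction on its derivation; the inverse
   [con_of_ty] of [TT] shows that [TT C = TT D] implies [C = D], as is needed
   for variables.

   For existence, the difficulty is that subterms may have types that the type
   of the whole term does not determine, as in [[] == []], and that are not of
   the form [TT F] with [F] ground.  Constructors are therefore interpreted in
   a set-theoretic model, with ground type trees for [Type], lists of labelled
   trees for [Row] and functions for arrows.  Equivalent types have the same
   value, and a ground constructor is equivalent to the reification of its
   value.  By induction on typing, a term of type [A] is then transformed at the
   reification of the value of [A]; neither confluence nor normalisation of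
   constructor reduction is involved. *)

Require Import Defs.
From Stdlib Require Import List String Permutation.
From Stdlib Require Import FunctionalExtensionality Eqdep_dec OrdersEx.

(** * Equivalence and typing *)

Lemma con_labels_ren xi S : con_labels (con_ren xi S) = con_labels S.
Proof. induction S; simpl; congruence. Qed.

Lemma kinding_ren Delta C K :
  kinding Delta C K -> forall Delta' xi,
  (forall n K', nth_error Delta n = Some K' -> nth_error Delta' (xi n) = Some K') ->
  kinding Delta' (con_ren xi C) K.
Proof.
  induction 1; intros Delta' xi Hxi; simpl; try (econstructor; eauto; fail).
  - constructor. apply IHkinding. intros [|n] K'; simpl; auto.
  - constructor; auto. rewrite con_labels_ren; auto.
Qed.

Lemma kinding_shift Delta C K K' :
  kinding Delta C K -> kinding (K' :: Delta) (con_shift C) K.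
Proof. intros H; eapply kinding_ren; eauto. Qed.

(** The context grows at its far end, so de Bruijn indices keep their meaning and nothing is
    renamed. Closed types of a context can thus be used over any [Delta]. *)
Lemma kinding_weaken Delta E C K :
  kinding Delta C K -> kinding (Delta ++ E) C K.
Proof.
  induction 1; try (econstructor; eauto; fail).
  constructor. rewrite nth_error_app1; auto.
  apply nth_error_Some; congruence.
Qed.

Lemma ceq_weaken Delta E C D K : ceq Delta C D K -> ceq (Delta ++ E) C D K.
Proof.
  induction 1; eauto using kinding_weaken; try (econstructor; eauto using kinding_weaken; fail).
Qed.

Lemma ceq_kinding Delta C D K :
  ceq Delta C D K -> kinding Delta C K /\ kinding Delta D K.
Proof.
  induction 1;
    repeat match goal with H : _ /\ _ |- _ => destruct H end;
    try (split; (assumption || econstructor; eauto); fail).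
  - split; auto. constructor. econstructor; [eapply kinding_shift; eauto|].
    constructor; reflexivity.
  - split; auto. inversion H; subst. inversion H4; subst. simpl in *.
    repeat constructor; simpl; intuition congruence.
Qed.

Scheme teq_mut := Minimality for teq Sort Prop
with req_mut := Minimality for req Sort Prop.
Combined Scheme teq_req_ind from teq_mut, req_mut.
Scheme ty_wf_min := Minimality for ty_wf Sort Prop
with row_wf_min := Minimality for row_wf Sort Prop.
Combined Scheme wf_ind from ty_wf_min, row_wf_min.

Lemma wf_weaken :
  (forall Delta A, ty_wf Delta A -> forall E, ty_wf (Delta ++ E) A) /\
  (forall Delta R, row_wf Delta R -> forall E, row_wf (Delta ++ E) R).
Proof.
  apply wf_ind; intros; constructor; auto using kinding_weaken.
  apply H0.
Qed.

Lemma teq_weaken_mut :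
  (forall Delta A B, teq Delta A B -> forall E, teq (Delta ++ E) A B) /\
  (forall Delta R R', req Delta R R' -> forall E, req (Delta ++ E) R R').
Proof.
  destruct wf_weaken as [Hty Hrow].
  apply teq_req_ind; intros;
    try (econstructor; eauto using kinding_weaken, ceq_weaken; fail).
Qed.

Lemma teq_weaken Delta A B : teq nil A B -> teq Delta A B.
Proof. intros H. apply (proj1 teq_weaken_mut _ _ _ H Delta). Qed.

Lemma teq_wf_mut :
  (forall Delta A B, teq Delta A B -> ty_wf Delta A /\ ty_wf Delta B) /\
  (forall Delta R R', req Delta R R' -> row_wf Delta R /\ row_wf Delta R').
Proof.
  apply teq_req_ind; intros;
    repeat match goal with
    | H : _ /\ _ |- _ => destruct H
    | H : ceq _ _ _ _ |- _ => apply ceq_kinding in H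
    end;
    try (split; auto; repeat (constructor; auto); fail).
  - inversion H as [|? ? ? ? H1 H2 H3|]; subst.
    inversion H2 as [|? ? ? ? H4 H5 H6|]; subst. simpl in *.
    split; auto. repeat constructor; simpl; intuition congruence.
  - inversion H; subst. split; repeat constructor; auto.
Qed.

Lemma teq_kinding Delta A C : teq Delta A (TT C) -> kinding Delta C KType.
Proof.
  intros H. apply (proj1 teq_wf_mut) in H. destruct H as [_ H].
  inversion H; auto.
Qed.

(* A left inverse of [TT] compatible with equivalence.  Arrow and universal
   types have no constructor counterpart; any constant will do for them. *)
Fixpoint con_of_ty (A : ty) : con :=
  match A with
  | TT C => C
  | TBase b => CBase b
  | TArr _ _ | TAll _ _ => CBase BBool
  | TList A => CList (con_of_ty A)
  | TRecord R => CRecord (con_of_row R)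
  | TTrace A => CTrace (con_of_ty A)
  end
with con_of_row (R : row) : con :=
  match R with
  | REmpty => CEmpty
  | RField l A R => CField l (con_of_ty A) (con_of_row R)
  | RT r => r
  end.

Lemma con_labels_of_row R : con_labels (con_of_row R) = row_labels R.
Proof. induction R; simpl; congruence. Qed.

Lemma kinding_con_of :
  (forall Delta A, ty_wf Delta A -> kinding Delta (con_of_ty A) KType) /\
  (forall Delta R, row_wf Delta R -> kinding Delta (con_of_row R) KRow).
Proof.
  apply wf_ind; intros; simpl; auto; constructor; auto.
  rewrite con_labels_of_row; auto.
Qed.

(** The rules that push [TT] or [RT] through a former have the same image on both sides and become
    reflexivity. So do the congruences for arrows and universals, which are sent to a constant; the
    other rules have counterparts in [ceq]. *)
Lemma teq_con_of_mut :
  (forall Delta A B, teq Delta A B ->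
     ceq Delta (con_of_ty A) (con_of_ty B) KType) /\
  (forall Delta R R', req Delta R R' ->
     ceq Delta (con_of_row R) (con_of_row R') KRow).
Proof.
  destruct kinding_con_of as [Hty Hrow].
  apply teq_req_ind; intros; simpl; auto;
    try (constructor; auto using k_base; fail);
    try (econstructor; eauto; fail).
  - constructor; simpl; auto using k_list.
  - constructor; simpl; auto using k_record.
  - constructor; simpl; auto using k_trace.
  - apply ce_field; rewrite ?con_labels_of_row; auto.
  - apply ce_swap. apply Hrow in H. exact H.
  - constructor; constructor.
Qed.

Lemma TT_inj Delta C D : teq Delta (TT C) (TT D) -> ceq Delta C D KType.
Proof. apply (proj1 teq_con_of_mut). Qed.

Lemma typed_ren Delta G M A :
  typed Delta G M A -> forall G' xi,
  (forall x B, nth_error G x = Some B -> nth_error G' (xi x) = Some B) ->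
  typed Delta G' (tm_ren xi M) A.
Proof.
  assert (Hup : forall (G G' : list ty) xi B,
    (forall x A, nth_error G x = Some A -> nth_error G' (xi x) = Some A) ->
    forall x A, nth_error (B :: G) x = Some A ->
                nth_error (B :: G') (up_ren xi x) = Some A)
    by (intros ? ? ? ? ? [|x] ? ?; simpl in *; auto).
  assert (Hmap : forall (f : ty -> ty) (G G' : list ty) xi,
    (forall x A, nth_error G x = Some A -> nth_error G' (xi x) = Some A) ->
    forall x A, nth_error (map f G) x = Some A ->
                nth_error (map f G') (xi x) = Some A).
  { intros f G0 G1 xi Hx x B. rewrite !nth_error_map.
    destruct (nth_error G0 x) eqn:E; simpl; intros [= <-].
    rewrite (Hx _ _ E). reflexivity. }
  (* [value] is closed, so its renaming computes to itself. [t_conv] fits any term, so the rules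
     declared after it are tried by name before [econstructor]. *)
  induction 1; intros G' xi Hxi; try apply t_value;
    simpl;
    first [ eapply t_rmap | eapply t_typecase | eapply t_trlit | eapply t_trif
          | eapply t_trfor | eapply t_trcell | eapply t_tropeq
          | eapply t_tropplus | eapply t_tracecase | econstructor ];
    eauto 6.
Qed.

Lemma typed_shift Delta G M A B :
  typed Delta G M A -> typed Delta (B :: G) (tm_shift M) A.
Proof. intros H; eapply typed_ren; eauto. Qed.

(** * The constructor TRACE *)

(** The beta reduct of [TRACE C]: the branches are closed, so the substitution leaves them alone. *)
Definition trec (C : con) : con :=
  CTyperec C
    (CTrace (CBase BBool)) (CTrace (CBase BInt)) (CTrace (CBase BString))
    (CLam KType (CLam KType (CList (CVar 0))))
    (CLam KRow (CLam KRow (CRecord (CVar 0))))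
    (CLam KType (CLam KType (CVar 0))).

Lemma kinding_trec Delta C : kinding Delta C KType -> kinding Delta (trec C) KType.
Proof. intros H. unfold trec. repeat (constructor; auto). Qed.

Lemma kinding_TRACE Delta : kinding Delta TRACE (KArr KType KType).
Proof. constructor. apply kinding_trec. constructor; reflexivity. Qed.

Lemma kinding_TRACE_app Delta C :
  kinding Delta C KType -> kinding Delta (CApp TRACE C) KType.
Proof. intros H. econstructor; eauto using kinding_TRACE. Qed.

Lemma TRACE_unfold Delta C :
  kinding Delta C KType -> ceq Delta (CApp TRACE C) (trec C) KType.
Proof.
  intros H. apply ce_step; auto using kinding_TRACE_app, kinding_trec.
  exact (s_beta KType (trec (CVar 0)) C).
Qed.

Lemma TRACE_base Delta b :
  ceq Delta (CApp TRACE (CBase b)) (CTrace (CBase b)) KType.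
Proof.
  eapply ce_trans; [apply TRACE_unfold; constructor|].
  apply ce_step; [apply kinding_trec| |]; repeat constructor.
  destruct b; constructor.
Qed.

(** [ceq] relates well-kinded constructors only, so the term between the two beta steps needs a
    kinding of its own. The result is given by an equation so that [F] can be stated in simplified
    form. *)
Lemma app2_beta Delta K1 K2 K3 C D E F :
  con_sub (inst E) (con_sub (up_sub (inst D)) C) = F ->
  kinding (K2 :: K1 :: Delta) C K3 ->
  kinding (K2 :: Delta) (con_sub (up_sub (inst D)) C) K3 ->
  kinding Delta D K1 -> kinding Delta E K2 -> kinding Delta F K3 ->
  ceq Delta (CApp (CApp (CLam K1 (CLam K2 C)) D) E) F K3.
Proof.
  intros <- H1 H2 HD HE HF. apply ce_trans with
    (CApp (CLam K2 (con_sub (up_sub (inst D)) C)) E).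
  - apply ce_step; [| |apply s_app1, s_beta]; repeat (econstructor; eauto).
  - apply ce_step; auto; [|apply s_beta]. repeat (econstructor; eauto).
Qed.

Lemma TRACE_list Delta C :
  kinding Delta C KType ->
  ceq Delta (CApp TRACE (CList C)) (CList (CApp TRACE C)) KType.
Proof.
  intros H. pose proof (kinding_trec _ _ H) as HT.
  eapply ce_trans; [apply TRACE_unfold; constructor; auto|].
  eapply ce_trans; [apply ce_step; [| |apply s_rec_list]|].
  - apply kinding_trec; constructor; auto.
  - repeat (econstructor; eauto).
  - eapply ce_trans.
    + apply app2_beta with (F := CList (trec C)); simpl;
        repeat (assumption || constructor).
    + apply ce_list, ce_sym, TRACE_unfold; auto.
Qed.

Lemma TRACE_trace Delta C :
  kinding Delta C KType ->
  ceq Delta (CApp TRACE (CTrace C)) (CApp TRACE C) KType.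
Proof.
  intros H. pose proof (kinding_trec _ _ H) as HT.
  eapply ce_trans; [apply TRACE_unfold; constructor; auto|].
  eapply ce_trans; [apply ce_step; [| |apply s_rec_trace]|].
  - apply kinding_trec; constructor; auto.
  - repeat (econstructor; eauto).
  - eapply ce_trans.
    + apply app2_beta with (F := trec C); simpl; auto; constructor; reflexivity.
    + apply ce_sym, TRACE_unfold; auto.
Qed.

Lemma kinding_rmap_TRACE Delta S :
  kinding Delta S KRow -> kinding Delta (CRmap TRACE S) KRow.
Proof. intros H; constructor; auto using kinding_TRACE. Qed.

(** The function that the reduct of the Typerec maps over [S] is [TRACE] itself, again because the
    branches are closed. *)
Lemma TRACE_record Delta S :
  kinding Delta S KRow ->
  ceq Delta (CApp TRACE (CRecord S)) (CRecord (CRmap TRACE S)) KType.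
Proof.
  intros H. pose proof (kinding_rmap_TRACE _ _ H) as HT.
  eapply ce_trans; [apply TRACE_unfold; constructor; auto|].
  eapply ce_trans; [apply ce_step; [| |apply s_rec_record]|].
  - apply kinding_trec; constructor; auto.
  - eapply k_app; [|exact HT]. repeat (econstructor; eauto).
  - apply app2_beta; simpl; auto; try exact HT; repeat constructor;
      auto using kinding_TRACE.
Qed.

Lemma rmap_TRACE_empty Delta : ceq Delta (CRmap TRACE CEmpty) CEmpty KRow.
Proof.
  apply ce_step; auto using kinding_rmap_TRACE, k_empty, s_rmap_empty.
Qed.

Lemma kinding_field_inv Delta l C S K :
  kinding Delta (CField l C S) K ->
  kinding Delta C KType /\ kinding Delta S KRow /\ ~ In l (con_labels S).
Proof. inversion 1; auto. Qed.

Lemma rmap_TRACE_field Delta l C S :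
  kinding Delta (CField l C S) KRow ->
  ceq Delta (CRmap TRACE (CField l C S))
            (CField l (CApp TRACE C) (CRmap TRACE S)) KRow.
Proof.
  intros H. apply ce_step; auto using kinding_rmap_TRACE, s_rmap_field.
  apply kinding_field_inv in H. destruct H as (H1 & H2 & H3).
  constructor; auto using kinding_rmap_TRACE, kinding_TRACE_app.
Qed.

Lemma TRACE_cong Delta C D :
  ceq Delta C D KType -> ceq Delta (CApp TRACE C) (CApp TRACE D) KType.
Proof.
  intros H. eapply ce_app; eauto. apply ce_refl, kinding_TRACE.
Qed.

Lemma wf_TT Delta C : kinding Delta C KType -> ty_wf Delta (TT C).
Proof. constructor; auto. Qed.

Lemma typed_ceq Delta G M C D :
  typed Delta G M (TT C) -> ceq Delta C D KType -> typed Delta G M (TT D).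
Proof.
  intros HM H. eapply t_conv; eauto. apply te_T, ce_sym; auto.
Qed.

Lemma teq_TRACE_base Delta b :
  teq Delta (TT (CApp TRACE (CBase b))) (TTrace (TBase b)).
Proof.
  eapply te_trans; [apply te_T, TRACE_base|].
  eapply te_trans; [apply te_T_trace; constructor|].
  apply te_trace, te_T_base.
Qed.

Lemma teq_TRACE_list Delta C :
  kinding Delta C KType ->
  teq Delta (TT (CApp TRACE (CList C))) (TList (TT (CApp TRACE C))).
Proof.
  intros H. eapply te_trans; [apply te_T, TRACE_list; auto|].
  apply te_T_list, kinding_TRACE_app; auto.
Qed.

Lemma teq_TRACE_record Delta S :
  kinding Delta S KRow ->
  teq Delta (TT (CApp TRACE (CRecord S))) (TRecord (RT (CRmap TRACE S))).
Proof.
  intros H. eapply te_trans; [apply te_T, TRACE_record; auto|].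
  apply te_T_record, kinding_rmap_TRACE; auto.
Qed.

Lemma req_TRACE_field Delta l C S :
  kinding Delta (CField l C S) KRow ->
  req Delta (RT (CRmap TRACE (CField l C S)))
            (RField l (TT (CApp TRACE C)) (RT (CRmap TRACE S))).
Proof.
  intros H. pose proof (rmap_TRACE_field _ _ _ _ H) as HE.
  eapply re_trans; [apply re_T; exact HE|].
  apply re_T_field. apply (ceq_kinding _ _ _ _ HE).
Qed.

Lemma typed_recext_TRACE Delta G l C S M N :
  kinding Delta (CField l C S) KRow ->
  typed Delta G M (TT (CApp TRACE C)) ->
  typed Delta G N (TRecord (RT (CRmap TRACE S))) ->
  typed Delta G (RecExt l M N) (TRecord (RT (CRmap TRACE (CField l C S)))).
Proof.
  intros H HM HN. eapply t_conv; [|apply te_record, req_TRACE_field; auto].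
  apply kinding_field_inv in H. destruct H as (H1 & H2 & H3).
  apply t_recext; auto.
  repeat (constructor; auto using kinding_TRACE_app, kinding_TRACE).
Qed.

(** * Projection of an arbitrary field of a row *)

Fixpoint in_row (l : label) (C S : con) : Prop :=
  match S with
  | CField l' C' S' => (l = l' /\ C = C') \/ in_row l C S'
  | _ => False
  end.

Lemma in_row_label l C S : in_row l C S -> In l (con_labels S).
Proof. induction S; simpl; intuition. Qed.

(** [t_proj] reads the first field only, so the field is moved to the front by swaps. The inclusion
    of labels serves the induction: it keeps the label that is swapped back fresh for the new
    tail. *)
Lemma in_row_front Delta l C S :
  in_row l C S -> kinding Delta S KRow ->
  exists S', ceq Delta S (CField l C S') KRow /\
             incl (con_labels S') (con_labels S).
Proof.
  induction S; simpl; try contradiction.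
  intros [[<- <-]|Hin] HK.
  - exists S2. split; [apply ce_refl; auto|]. apply incl_tl, incl_refl.
  - pose proof (kinding_field_inv _ _ _ _ _ HK) as (H1 & H2 & H3).
    destruct (IHS2 Hin H2) as (S' & HS' & Hl).
    pose proof (proj2 (ceq_kinding _ _ _ _ HS')) as HK'.
    pose proof (kinding_field_inv _ _ _ _ _ HK') as (H1' & H2' & H3').
    assert (Hne : l0 <> l) by (intros ->; apply in_row_label in Hin; auto).
    assert (HF : ~ In l0 (con_labels (CField l C S')))
      by (simpl; intros [E|Hx]; [congruence|apply H3; auto]).
    exists (CField l0 S1 S'). split.
    + eapply ce_trans; [apply ce_field; [apply ce_refl| exact HS' | |]; auto|].
      apply ce_swap. constructor; auto.
    + simpl. intros x [<-|Hx]; simpl; auto.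
Qed.

Lemma typed_proj_row Delta G M l C S :
  in_row l C S -> kinding Delta S KRow ->
  typed Delta G M (TT (CRecord S)) -> typed Delta G (Proj M l) (TT C).
Proof.
  intros Hin HK HM. destruct (in_row_front _ _ _ _ Hin HK) as (S' & HS & _).
  pose proof (ceq_kinding _ _ _ _ HS) as [_ HK'].
  apply t_proj with (R := RT S'). eapply t_conv; [exact HM|].
  eapply te_trans; [apply te_record, re_sym, re_T_field; auto|].
  eapply te_trans; [apply te_record, re_T, ce_sym; eauto|].
  apply te_sym, te_T_record; auto.
Qed.

Lemma kinding_row_inv Delta S :
  kinding Delta (CRecord S) KType -> kinding Delta S KRow.
Proof. inversion 1; auto. Qed.

Lemma kinding_list_inv Delta C :
  kinding Delta (CList C) KType -> kinding Delta C KType.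
Proof. inversion 1; auto. Qed.

Lemma kinding_trace_inv Delta C :
  kinding Delta (CTrace C) KType -> kinding Delta C KType.
Proof. inversion 1; auto. Qed.

(** * Typing of [dist] *)

Definition hole_ok (Delta : list kind) (G : list ty) (k : hole_tm) : Prop :=
  match k with
  | HFor D M => kinding Delta D KType /\ typed Delta G M (TT (CApp TRACE D))
  | HIf L => typed Delta G L (TT (CApp TRACE (CBase BBool)))
  end.

Lemma hole_ok_shift Delta G k A :
  hole_ok Delta G k -> hole_ok Delta (A :: G) (hole_shift k).
Proof. destruct k; simpl; intuition auto using typed_shift. Qed.

Lemma typed_pair Delta G l1 l2 M N A B :
  l1 <> l2 -> ty_wf Delta A -> ty_wf Delta B ->
  typed Delta G M A -> typed Delta G N B ->
  typed Delta G (record_tm [(l1, M); (l2, N)])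
    (TRecord (record_row [(l1, A); (l2, B)])).
Proof.
  intros Hl HA HB HM HN. simpl.
  repeat (apply t_recext || apply t_recnil || apply w_field || apply w_empty
          || assumption); simpl; intuition congruence.
Qed.

Lemma typed_fill Delta G k t C :
  hole_ok Delta G k -> kinding Delta C KType ->
  typed Delta G t (TTrace (TT C)) -> typed Delta G (fill k t) (TTrace (TT C)).
Proof.
  intros Hk HC Ht.
  assert (HW : ty_wf Delta (TTrace (TT C))) by (repeat constructor; auto).
  destruct k as [D M|L]; simpl in Hk.
  - destruct Hk as [HD HM]. apply t_trfor; auto.
    apply typed_pair; auto; [discriminate|].
    apply wf_TT, kinding_TRACE_app; auto.
  - apply t_trif. apply typed_pair; auto; [discriminate|repeat constructor|].
    eapply t_conv; [exact Hk|]. apply te_sym, teq_TRACE_base.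
Qed.

(** [dist] descends from a record to its row with [t] still standing for the whole record. The claim
    for rows therefore assumes typings of the projections of [t], one for each remaining field,
    instead of a typing of [t]. *)
Lemma typed_dist F : forall Delta G k t P,
  hole_ok Delta G k -> dist F k t = Some P ->
  (kinding Delta F KType -> typed Delta G t (TT F) ->
   typed Delta G P (TT F)) /\
  (kinding Delta F KRow ->
   (forall l C, in_row l C F -> typed Delta G (Proj t l) (TT C)) ->
   typed Delta G P (TRecord (RT F))).
Proof.
  induction F; intros Delta G k t P Hk HP; simpl in HP; try discriminate.
  - split; [|intros HF; inversion HF]. intros HF Ht.
    apply kinding_list_inv in HF.
    destruct (dist F (hole_shift k) (Var 0)) as [Q|] eqn:E; [|discriminate].
    injection HP as <-.
    eapply t_conv; [|apply te_T_list; auto].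
    apply t_for with (A := TT F).
    + eapply t_conv; [exact Ht|]. apply te_sym, te_T_list; auto.
    + apply t_single. eapply IHF; eauto using hole_ok_shift.
      constructor; reflexivity.
  - split; [|intros HF; inversion HF]. intros HF Ht.
    apply kinding_row_inv in HF.
    eapply t_conv; [|apply te_T_record; auto].
    eapply IHF; eauto. intros l C Hin. eapply typed_proj_row; eauto.
  - split; [|intros HF; inversion HF]. intros HF Ht.
    apply kinding_trace_inv in HF. injection HP as <-.
    eapply t_conv; [|apply te_T_trace; auto].
    apply typed_fill; auto. eapply t_conv; [exact Ht|].
    apply te_sym, te_T_trace; auto.
  - injection HP as <-. split; [intros HF; inversion HF|]. intros _ _.
    eapply t_conv; [apply t_recnil|]. apply te_record, re_T_empty.
  - split; [intros HF; inversion HF|]. intros HF Hproj.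
    destruct (dist F1 k (Proj t l)) as [Q1|] eqn:E1; [|discriminate].
    destruct (dist F2 k t) as [Q2|] eqn:E2; [|discriminate].
    injection HP as <-.
    eapply t_conv; [|apply te_record, re_T_field; auto].
    apply kinding_field_inv in HF. destruct HF as (H1 & H2 & H3).
    apply t_recext.
    + eapply IHF1; eauto. apply Hproj; simpl; auto.
    + eapply IHF2; eauto. intros l' C Hin. apply Hproj; simpl; auto.
    + repeat (constructor; auto).
Qed.

Lemma typed_dist_at Delta G C k t P :
  hole_ok Delta G k -> dist_at Delta C k t P -> typed Delta G t (TT C) ->
  typed Delta G P (TT C).
Proof.
  intros Hk (F & HF & HP) Ht. eapply typed_ceq; [|apply ce_sym; eauto].
  eapply typed_dist; eauto using typed_ceq. apply (ceq_kinding _ _ _ _ HF).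
Qed.

(** * Soundness of the transformation *)

Lemma con_labels_base_con_row fs : con_labels (base_con_row fs) = map fst fs.
Proof. induction fs; simpl; congruence. Qed.

Lemma row_labels_base_row fs : row_labels (base_row fs) = map fst fs.
Proof. induction fs; simpl; congruence. Qed.

Lemma kinding_base_con_row Delta fs :
  NoDup (map fst fs) -> kinding Delta (base_con_row fs) KRow.
Proof.
  induction fs as [|[l b] fs IH]; simpl; intros H; constructor;
    inversion H; subst; auto using k_base.
  rewrite con_labels_base_con_row; auto.
Qed.

Lemma req_base_row Delta fs :
  NoDup (map fst fs) -> req Delta (base_row fs) (RT (base_con_row fs)).
Proof.
  intros H. pose proof (kinding_base_con_row Delta fs H) as HK. revert H HK.
  induction fs as [|[l b] fs IH]; simpl; intros H HK.
  - apply re_sym, re_T_empty.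
  - inversion H; subst. eapply re_trans; [|apply re_sym, re_T_field; auto].
    apply re_field.
    + apply te_sym, te_T_base.
    + apply IH; auto. apply (kinding_field_inv _ _ _ _ _ HK).
    + rewrite row_labels_base_row; auto.
    + simpl. rewrite con_labels_base_con_row; auto.
Qed.

Lemma teq_base_record Delta fs :
  NoDup (map fst fs) ->
  teq Delta (TRecord (base_row fs)) (TT (CRecord (base_con_row fs))).
Proof.
  intros H. eapply te_trans; [apply te_record, req_base_row; auto|].
  apply te_sym, te_T_record, kinding_base_con_row; auto.
Qed.

Lemma trans_kinding Delta G M C M' :
  trans Delta G M C M' -> kinding Delta C KType.
Proof.
  induction 1; try (repeat constructor; auto; fail); auto.
  - eapply teq_kinding; eauto.
  - constructor; auto.
  - inversion IHtrans as [ | | | | |S0 HS| | | | | ]; subst.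
    apply (kinding_field_inv _ _ _ _ _ HS).
  - apply k_list, k_record, kinding_base_con_row; auto.
  - apply (ceq_kinding _ _ _ _ H0).
Qed.

(** [trace_ctx] with equivalence over [Delta]: the element type of a comprehension, which enters the
    context under [for], may mention type variables. *)
Definition trace_ctx_in (Delta : list kind) : list ty -> list ty -> Prop :=
  Forall2 (fun A A' =>
    exists C, teq Delta A (TT C) /\ A' = TT (CApp TRACE C)).

Lemma trace_ctx_nth Delta G G' x A :
  trace_ctx_in Delta G G' -> nth_error G x = Some A ->
  exists C, teq Delta A (TT C) /\ nth_error G' x = Some (TT (CApp TRACE C)).
Proof.
  intros H. revert x. induction H as [|A1 A2 G G' (C & HC & ->) _ IH];
    intros [|x] Hx; simpl in *; try discriminate; eauto.
  injection Hx as <-. eauto.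
Qed.

Lemma in_row_base l b fs : In (l, b) fs -> in_row l (CBase b) (base_con_row fs).
Proof.
  induction fs as [|[l' b'] fs IH]; simpl; [tauto|].
  intros [[= <- <-]|H]; auto.
Qed.

(** The Trace branch of [VALUE] returns its first argument, so [VALUE] at [Trace Bool] reduces to
    [Bool], as a condition requires. *)
Lemma typed_value_trace_bool Delta G L :
  typed Delta G L (TT (CApp TRACE (CBase BBool))) ->
  typed Delta G (App (TApp value (CTrace (CBase BBool))) L) (TBase BBool).
Proof.
  intros HL.
  set (V := CApp VALUE (CTrace (CBase BBool))).
  assert (HV : kinding Delta VALUE (KArr KType KType))
    by (repeat (econstructor; simpl; eauto)).
  assert (HE : ceq Delta V (CBase BBool) KType).
  { eapply ce_trans; [apply ce_step; [| |apply s_beta]|];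
      [repeat (econstructor; simpl; eauto)..|].
    simpl. eapply ce_trans; [apply ce_step; [| |apply s_rec_trace]|];
      [repeat (econstructor; simpl; eauto)..|].
    apply app2_beta; repeat (econstructor; simpl; eauto). }
  assert (HA : typed Delta G (TApp value (CTrace (CBase BBool)))
    (TArr (TT (CTrace (CBase BBool))) (TT V))).
  { apply (t_tapp Delta G KType
      (TArr (TT (CVar 0)) (TT (CApp VALUE (CVar 0))))).
    - apply t_value.
    - repeat constructor.
    - simpl. repeat (econstructor; simpl; eauto). }
  eapply t_conv; [eapply t_app; [exact HA|]|].
  - eapply typed_ceq; [exact HL|]. apply TRACE_base.
  - eapply te_trans; [apply te_sym, te_T_base|]. apply te_T, ce_sym, HE.
Qed.

(** The induction consumes [fs] while the row variable keeps the type of the whole table [tf]; by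
    the inclusion every cell can project its own field and [oid] from it. *)
Lemma typed_cell_record Delta G n tf fs :
  NoDup (map fst tf) -> In ("oid"%string, BInt) tf ->
  NoDup (map fst fs) -> incl fs tf ->
  typed Delta (TRecord (base_row tf) :: G) (cell_record n fs)
    (TRecord (RT (CRmap TRACE (base_con_row fs)))).
Proof.
  intros Htf Hoid.
  assert (Hproj : forall l b, In (l, b) tf ->
    typed Delta (TRecord (base_row tf) :: G) (Proj (Var 0) l) (TBase b)).
  { intros l b Hin. eapply t_conv; [|apply te_sym, te_T_base].
    eapply typed_proj_row; [apply in_row_base; eauto| |].
    - apply kinding_base_con_row; auto.
    - eapply t_conv; [apply t_var; reflexivity|].
      apply te_sym, teq_base_record; auto. }
  induction fs as [|[l b] fs IH]; intros Hfs Hincl.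
  - eapply t_conv; [apply t_recnil|]. apply te_record.
    eapply re_trans; [apply re_T, rmap_TRACE_empty|]. apply re_T_empty.
  - pose proof (kinding_base_con_row Delta _ Hfs) as HK.
    inversion Hfs; subst.
    change (typed Delta (TRecord (base_row tf) :: G)
      (RecExt l (TrCell (record_tm
         [("tbl", Const (KString n)); ("col", Const (KString l));
          ("row", Proj (Var 0) "oid"); ("val", Proj (Var 0) l)]))%string
         (cell_record n fs))
      (TRecord (RT (CRmap TRACE (CField l (CBase b) (base_con_row fs)))))).
    apply typed_recext_TRACE; auto.
    + eapply t_conv; [|apply teq_TRACE_base]. apply t_trcell.
      assert (Hl : In (l, b) tf) by (apply Hincl; simpl; auto).
      pose proof (Hproj _ _ Hl). pose proof (Hproj _ _ Hoid). simpl.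
      repeat (apply t_recext || apply t_recnil || apply w_field
              || apply w_empty || apply w_base || assumption
              || apply (t_const Delta _ (KString _)));
        simpl; intuition congruence.
    + apply IH; auto. intros x Hx; apply Hincl; simpl; auto.
Qed.

(** By induction on the transformation, which records the constructors at which the subterms are
    transformed; the typing of [M] is not consulted. *)
Lemma trans_typed Delta G M C M' :
  trans Delta G M C M' -> forall G', trace_ctx_in Delta G G' ->
  typed Delta G' M' (TT (CApp TRACE C)).
Proof.
  induction 1; intros G' HG.
  (* The trace context and the transformation may name the type of [x] by different constructors.
     Injectivity of [TT] makes them equivalent, and hence their images under [TRACE]. *)
  - destruct (trace_ctx_nth _ _ _ _ _ HG H) as (C0 & HC0 & Hx).
    eapply typed_ceq; [apply t_var; exact Hx|].
    apply TRACE_cong, TT_inj. eapply te_trans; [apply te_sym|]; eauto.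
  - eapply t_conv; [apply t_trlit|]. apply teq_TRACE_base.
  - eapply t_conv; [|apply teq_TRACE_base]. apply t_tropplus.
    apply typed_pair; try discriminate; try (repeat constructor; fail);
      (eapply t_conv; [eauto|apply te_sym, teq_TRACE_base]).
  - eapply t_conv; [|apply teq_TRACE_base].
    pose proof (trans_kinding _ _ _ _ _ H) as HC.
    apply t_tropeq; auto.
    apply typed_pair; auto using wf_TT, kinding_TRACE_app; discriminate.
  - eapply t_conv; [apply t_recnil|].
    eapply te_trans; [apply teq_TRACE_record; constructor|].
    apply te_record. eapply re_trans; [apply re_T, rmap_TRACE_empty|].
    apply re_T_empty.
  - pose proof (kinding_field_inv _ _ _ _ _ H1) as (_ & HS & _).
    eapply t_conv; [|apply teq_TRACE_record; auto].
    apply typed_recext_TRACE; auto.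
    eapply t_conv; [apply IHtrans2; auto|].
    apply te_sym, teq_TRACE_record; auto.
  - pose proof (trans_kinding _ _ _ _ _ H) as HC.
    apply kinding_row_inv in HC.
    apply t_proj with (R := RT (CRmap TRACE S)).
    eapply t_conv; [apply IHtrans; auto|].
    eapply te_trans; [apply te_record, re_sym, req_TRACE_field; auto|].
    apply te_sym, teq_TRACE_record; auto.
  - eapply t_conv; [|apply teq_TRACE_list; auto].
    apply t_nil, wf_TT, kinding_TRACE_app; auto.
  - eapply t_conv; [|apply teq_TRACE_list; eapply trans_kinding; eauto].
    apply t_single; auto.
  - pose proof (kinding_list_inv _ _ (trans_kinding _ _ _ _ _ H)) as HC.
    eapply t_conv; [|apply teq_TRACE_list; auto].
    apply t_append; (eapply t_conv; [eauto|apply te_sym, teq_TRACE_list; auto]).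
  - assert (HK : kinding Delta (CRecord (base_con_row (table_fields R))) KType)
      by (constructor; apply kinding_base_con_row; auto).
    eapply t_conv; [|apply teq_TRACE_list; auto].
    eapply t_for; [apply t_table; auto|]. apply t_single.
    eapply t_conv; [|apply teq_TRACE_record, kinding_base_con_row; auto].
    apply typed_cell_record; auto using incl_refl. left; reflexivity.
  - pose proof (kinding_list_inv _ _ (trans_kinding _ _ _ _ _ H)) as HD.
    pose proof (kinding_list_inv _ _ (trans_kinding _ _ _ _ _ H0)) as HC.
    (* The loop variable gets the type [TRACE D], which is the one that the [in] field of the hole
       demands. *)
    assert (HG' : trace_ctx_in Delta (TT D :: G) (TT (CApp TRACE D) :: G')).
    { constructor; auto. exists D. split; auto. apply te_refl, wf_TT; auto. }
    eapply t_conv; [|apply teq_TRACE_list; auto].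
    eapply t_for.
    + eapply t_conv; [apply IHtrans1; auto|]. apply te_sym, teq_TRACE_list; auto.
    + eapply t_conv; [|apply te_sym, teq_TRACE_list; auto].
      eapply typed_dist_at; [|eauto|apply IHtrans2; auto].
      split; auto. constructor; reflexivity.
  - apply t_if.
    + apply typed_value_trace_bool; auto.
    + eapply typed_dist_at; [|eauto|apply IHtrans2; auto]. simpl; auto.
    + eapply typed_dist_at; [|eauto|apply IHtrans3; auto]. simpl; auto.
  - eapply typed_ceq; [apply IHtrans; auto|]. apply TRACE_cong; auto.
Qed.

(** * A set-theoretic model of constructors *)

Inductive gty : Set :=
| GBase (b : base)
| GList (g : gty)
| GRec (r : list (label * gty))
| GTrace (g : gty).

Definition grow : Set := list (label * gty).

(** The nested recursion through the list under [GRec] calls for an induction principle with a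
    hypothesis for each field. *)
Fixpoint gty_ind_nested (P : gty -> Prop)
  (HB : forall b, P (GBase b))
  (HL : forall g, P g -> P (GList g))
  (HR : forall r, Forall (fun f => P (snd f)) r -> P (GRec r))
  (HT : forall g, P g -> P (GTrace g)) (g : gty) : P g :=
  match g with
  | GBase b => HB b
  | GList g => HL g (gty_ind_nested P HB HL HR HT g)
  | GRec r =>
      HR r ((fix all r : Forall (fun f => P (snd f)) r :=
        match r with
        | nil => Forall_nil _
        | cons f r => Forall_cons f (gty_ind_nested P HB HL HR HT (snd f)) (all r)
        end) r)
  | GTrace g => HT g (gty_ind_nested P HB HL HR HT g)
  end.

(* Insertion before the first label that is not smaller.  It makes the value
   of a row independent of the order of its fields. *)
Fixpoint ginsert (l : label) (g : gty) (r : grow) : grow :=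
  match r with
  | nil => [(l, g)]
  | cons (l', g') r' =>
      if String.leb l l' then (l, g) :: r else (l', g') :: ginsert l g r'
  end.

Lemma leb_trans x y z :
  String.leb x y = true -> String.leb y z = true -> String.leb x z = true.
Proof.
  unfold String.leb. intros H1 H2.
  destruct (String.compare x y) eqn:E1; try discriminate.
  - apply String.compare_eq_iff in E1. subst. exact H2.
  - destruct (String.compare y z) eqn:E2; try discriminate.
    + apply String.compare_eq_iff in E2. subst. rewrite E1. reflexivity.
    + pose proof (RelationClasses.StrictOrder_Transitive (R := String_as_OT.lt) x y z E1 E2)
        as E3.
      unfold String_as_OT.lt in E3. change (String.compare x z = Lt) in E3.
      rewrite E3. reflexivity.
Qed.

Lemma leb_flip x y : String.leb x y = false -> String.leb y x = true.
Proof. destruct (String.leb_total x y); congruence. Qed.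

(** Any label of [r] that stops the larger of the two labels also stops the smaller one, which
    therefore lands first in either order of insertion. Totality of the order reduces the claim to
    [l1] below [l2]. *)
Lemma ginsert_comm l1 g1 l2 g2 r :
  l1 <> l2 ->
  ginsert l1 g1 (ginsert l2 g2 r) = ginsert l2 g2 (ginsert l1 g1 r).
Proof.
  revert l1 g1 l2 g2.
  assert (Hlt : forall l1 g1 l2 g2 r, l1 <> l2 -> String.leb l1 l2 = true ->
    ginsert l1 g1 (ginsert l2 g2 r) = ginsert l2 g2 (ginsert l1 g1 r)).
  { intros l1 g1 l2 g2 r0 Hne H12.
    assert (H21 : String.leb l2 l1 = false).
    { destruct (String.leb l2 l1) eqn:E; auto.
      destruct Hne. apply String.leb_antisym; auto. }
    induction r0 as [|[l g] r0 IH]; simpl.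
    - rewrite H12, H21. reflexivity.
    - destruct (String.leb l2 l) eqn:E2.
      + rewrite (leb_trans _ _ _ H12 E2). simpl. rewrite H12, H21, E2.
        reflexivity.
      + destruct (String.leb l1 l) eqn:E1; simpl; rewrite ?E1, ?E2, ?H21.
        * reflexivity.
        * rewrite IH. reflexivity. }
  intros l1 g1 l2 g2 Hne. destruct (String.leb l1 l2) eqn:E; auto.
  symmetry. apply Hlt; auto using leb_flip.
Qed.

Lemma ginsert_perm l g r : Permutation (ginsert l g r) ((l, g) :: r).
Proof.
  induction r as [|[l' g'] r IH]; simpl; auto.
  destruct (String.leb l l'); auto.
  rewrite IH. apply perm_swap.
Qed.

Definition map_row (f : gty -> gty) (r : grow) : grow :=
  map (fun p => (fst p, f (snd p))) r.

Lemma map_row_ginsert f l g r :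
  map_row f (ginsert l g r) = ginsert l (f g) (map_row f r).
Proof.
  induction r as [|[l' g'] r IH]; simpl; auto.
  destruct (String.leb l l'); simpl; congruence.
Qed.

(** * Values of kinds and evaluation of constructors *)

Fixpoint den (K : kind) : Set :=
  match K with
  | KType => gty
  | KRow => grow
  | KArr K1 K2 => den K1 -> den K2
  end.

Fixpoint default (K : kind) : den K :=
  match K with
  | KType => GBase BBool
  | KRow => nil
  | KArr _ K2 => fun _ => default K2
  end.

Definition kvalue : Set := {K : kind & den K}.

Lemma kind_eq_dec (K1 K2 : kind) : {K1 = K2} + {K1 <> K2}.
Proof. decide equality. Defined.

(** Values in an environment are tagged with their kind; a lookup at another kind yields a default,
    which keeps [eval] total. *)
Definition cast (K : kind) (v : kvalue) : den K :=
  match kind_eq_dec (projT1 v) K with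
  | left e => eq_rec _ den (projT2 v) K e
  | right _ => default K
  end.

Lemma cast_same K d : cast K (existT _ K d) = d.
Proof.
  unfold cast; simpl. destruct (kind_eq_dec K K) as [e|n]; [|congruence].
  rewrite (UIP_dec kind_eq_dec e eq_refl). reflexivity.
Qed.

Definition scons {T : Type} (x : T) (f : nat -> T) : nat -> T :=
  fun n => match n with O => x | S m => f m end.

Definition arg_kind (K : kind) : kind :=
  match K with KArr K1 _ => K1 | _ => KType end.
Definition res_kind (K : kind) : kind :=
  match K with KArr _ K2 => K2 | _ => KType end.

(** An application does not record the kind at which its argument is to be evaluated, so [eval]
    reads it off the function part. *)
Fixpoint infer (g : nat -> kind) (C : con) : kind :=
  match C with
  | CVar n => g n
  | CLam K C => KArr K (infer (scons K g) C)
  | CApp C _ => res_kind (infer g C)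
  | CTyperec _ CB _ _ _ _ _ => infer g CB
  | CBase _ | CList _ | CRecord _ | CTrace _ => KType
  | CEmpty | CField _ _ _ | CRmap _ _ => KRow
  end.

Definition env := nat -> kvalue.
Definition kinds (rho : env) : nat -> kind := fun n => projT1 (rho n).

Definition to_type (K : kind) : den K -> gty :=
  match K with KType => fun d => d | _ => fun _ => GBase BBool end.

(* The reduct of Typerec over a record is well-kinded at kind [Type] only, so
   the branch [fr] matters only there. *)
Fixpoint rec_type (K : kind) (b i s : den K) (fl : gty -> den K -> den K)
  (fr : grow -> grow -> den K) (ft : gty -> den K -> den K) (g : gty) : den K :=
  match g with
  | GBase BBool => b
  | GBase BInt => i
  | GBase BString => s
  | GList g => fl g (rec_type K b i s fl fr ft g)
  | GRec r =>
      fr r (map (fun p => (fst p, to_type K (rec_type K b i s fl fr ft (snd p)))) r)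
  | GTrace g => ft g (rec_type K b i s fl fr ft g)
  end.

Definition at_type (K : kind) (g : gty) : den K :=
  match K with KType => g | K => default K end.
Definition at_row (K : kind) (r : grow) : den K :=
  match K with KRow => r | K => default K end.

(* [eval C K rho] is the value of [C] at kind [K]; it is junk unless [C] has
   kind [K] in a context matched by [rho]. *)
Fixpoint eval (C : con) : forall K : kind, env -> den K :=
  match C with
  | CBase b => fun K _ => at_type K (GBase b)
  | CVar n => fun K rho => cast K (rho n)
  | CLam _ C => fun K rho =>
      match K with
      | KArr K1 K2 => fun d => eval C K2 (scons (existT _ K1 d) rho)
      | K => default K
      end
  | CApp C D => fun K rho =>
      eval C (KArr (arg_kind (infer (kinds rho) C)) K) rho (eval D _ rho)
  | CList C => fun K rho => at_type K (GList (eval C KType rho))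
  | CRecord R => fun K rho => at_type K (GRec (eval R KRow rho))
  | CTrace C => fun K rho => at_type K (GTrace (eval C KType rho))
  | CTyperec C CB CI CS CL CR CT => fun K rho =>
      rec_type K (eval CB K rho) (eval CI K rho) (eval CS K rho)
        (eval CL (KArr KType (KArr K K)) rho)
        (eval CR (KArr KRow (KArr KRow K)) rho)
        (eval CT (KArr KType (KArr K K)) rho)
        (eval C KType rho)
  | CEmpty => fun K _ => at_row K nil
  | CField l C R => fun K rho =>
      at_row K (ginsert l (eval C KType rho) (eval R KRow rho))
  | CRmap C R => fun K rho =>
      at_row K (map_row (eval C (KArr KType KType) rho) (eval R KRow rho))
  end.

(** * Invariance of values under constructor equivalence *)

Definition matches (Delta : list kind) (g : nat -> kind) : Prop :=
  forall n K, nth_error Delta n = Some K -> g n = K.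

Lemma matches_scons Delta g K :
  matches Delta g -> matches (K :: Delta) (scons K g).
Proof. intros H [|n] K'; simpl; [congruence|apply H]. Qed.

Lemma kinds_scons K d rho :
  kinds (scons (existT _ K d) rho) = scons K (kinds rho).
Proof. apply functional_extensionality. intros [|n]; reflexivity. Qed.

Lemma infer_ren C : forall xi g,
  infer g (con_ren xi C) = infer (fun n => g (xi n)) C.
Proof.
  induction C; intros xi g; simpl; auto; [|rewrite IHC1; reflexivity].
  f_equal. rewrite IHC. f_equal. apply functional_extensionality.
  intros [|n]; reflexivity.
Qed.

Lemma eval_ren C : forall xi K rho,
  eval (con_ren xi C) K rho = eval C K (fun n => rho (xi n)).
Proof.
  induction C; intros xi K' rho; simpl;
    try (repeat match goal with
         | IH : forall xi K rho, _ = _ |- _ => rewrite IH; clear IH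
         end; reflexivity).
  - destruct K'; auto. apply functional_extensionality; intros d.
    rewrite IHC. f_equal. apply functional_extensionality.
    intros [|n]; reflexivity.
  - rewrite infer_ren, IHC1, IHC2. reflexivity.
Qed.

Lemma infer_kinding Delta C K :
  kinding Delta C K -> forall g, matches Delta g -> infer g C = K.
Proof.
  induction 1; intros g Hg; simpl; auto.
  - rewrite (IHkinding (scons K1 g)); auto using matches_scons.
  - rewrite IHkinding1; auto.
Qed.

(** Both kinds equal the result of [infer] on an assignment of kinds read off [Delta]. *)
Lemma kinding_unique Delta C K K' :
  kinding Delta C K -> kinding Delta C K' -> K = K'.
Proof.
  intros H H'.
  set (g := fun n => match nth_error Delta n with
                     | Some K => K | None => KType end).
  assert (Hg : matches Delta g)
    by (intros n K0 E; unfold g; rewrite E; reflexivity).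
  rewrite <- (infer_kinding _ _ _ H g Hg). apply (infer_kinding _ _ _ H' g Hg).
Qed.

Lemma eval_app Delta C D K1 K2 rho :
  matches Delta (kinds rho) -> kinding Delta C (KArr K1 K2) ->
  eval (CApp C D) K2 rho = eval C (KArr K1 K2) rho (eval D K1 rho).
Proof.
  intros Hrho HC. simpl. rewrite (infer_kinding _ _ _ HC _ Hrho). reflexivity.
Qed.

(** The two claims go together: evaluating an application after substitution uses the kind inferred
    for its substituted function part. *)
Lemma eval_sub Delta C K :
  kinding Delta C K -> forall s rho rho',
  (forall n K', nth_error Delta n = Some K' ->
     infer (kinds rho) (s n) = K' /\
     rho' n = existT _ K' (eval (s n) K' rho)) ->
  infer (kinds rho) (con_sub s C) = K /\
  eval (con_sub s C) K rho = eval C K rho'.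
Proof.
  assert (Hm : forall Delta s rho rho',
    (forall n K', nth_error Delta n = Some K' ->
       infer (kinds rho) (s n) = K' /\
       rho' n = existT _ K' (eval (s n) K' rho)) ->
    matches Delta (kinds rho')).
  { intros D s rho rho' H n K' E. unfold kinds.
    destruct (H n K' E) as [_ ->]. reflexivity. }
  assert (Hup : forall Delta s rho rho' K0 d,
    (forall n K', nth_error Delta n = Some K' ->
       infer (kinds rho) (s n) = K' /\
       rho' n = existT _ K' (eval (s n) K' rho)) ->
    (forall n K', nth_error (K0 :: Delta) n = Some K' ->
       infer (kinds (scons (existT _ K0 d) rho)) (up_sub s n) = K' /\
       scons (existT _ K0 d) rho' n =
         existT _ K' (eval (up_sub s n) K' (scons (existT _ K0 d) rho)))).
  { intros D s rho rho' K0 d H [|n] K' E; simpl in *.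
    - injection E as <-. rewrite cast_same. auto.
    - destruct (H n K' E) as [H1 H2]. unfold con_shift.
      rewrite infer_ren, eval_ren, H2, <- H1. auto. }
  induction 1; intros s rho rho' H';
    try (simpl; split; auto;
      repeat match goal with
      | IH : forall s rho rho', _ -> _ /\ _ |- _ =>
          destruct (IH s rho rho' H') as [_ ->]; clear IH
      end; auto; fail).
  - simpl. destruct (H' n K H) as [H1 H2]. rewrite H2, cast_same. auto.
  - simpl. split.
    (* Inference sees only the kind of the bound variable; the default is some value of that kind
       with which to extend the environment. *)
    + f_equal. rewrite <- (kinds_scons K1 (default K1)).
      eapply IHkinding. apply Hup; eauto.
    + apply functional_extensionality; intros d.
      eapply IHkinding. apply Hup; auto.
  - destruct (IHkinding1 _ _ _ H') as [E1 E2].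
    destruct (IHkinding2 _ _ _ H') as [E3 E4].
    rewrite (eval_app Delta C D K1 K2); eauto. simpl.
    rewrite E1. simpl. rewrite E2, E4. auto.
  - simpl. split.
    + eapply IHkinding2; eauto.
    + repeat match goal with
      | IH : forall s rho rho', _ -> _ /\ _ |- _ =>
          destruct (IH s rho rho' H') as [_ ->]; clear IH
      end. auto.
Qed.

Lemma kinding_app_inv Delta C D K2 :
  kinding Delta (CApp C D) K2 ->
  exists K1, kinding Delta C (KArr K1 K2) /\ kinding Delta D K1.
Proof. inversion 1; eauto. Qed.

Lemma eval_inst Delta C D K1 K2 rho :
  matches Delta (kinds rho) -> kinding (K1 :: Delta) C K2 ->
  kinding Delta D K1 ->
  eval (con_sub (inst D) C) K2 rho =
  eval C K2 (scons (existT _ K1 (eval D K1 rho)) rho).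
Proof.
  intros Hrho HC HD. eapply eval_sub; eauto.
  intros [|n] K' E; simpl in *.
  - injection E as <-. split; auto. eapply infer_kinding; eauto.
  - rewrite <- (Hrho n K' E). unfold kinds. destruct (rho n) as [K0 d].
    simpl. rewrite cast_same. auto.
Qed.

Lemma eval_scons_shift C K v rho :
  eval (con_shift C) K (scons v rho) = eval C K rho.
Proof. unfold con_shift. rewrite eval_ren. reflexivity. Qed.

Lemma eval_app2 Delta C D E K1 K2 K3 rho :
  matches Delta (kinds rho) -> kinding Delta C (KArr K1 (KArr K2 K3)) ->
  kinding Delta D K1 ->
  eval (CApp (CApp C D) E) K3 rho =
  eval C (KArr K1 (KArr K2 K3)) rho (eval D K1 rho) (eval E K2 rho).
Proof.
  intros Hrho HC HD. rewrite (eval_app Delta _ _ K2 K3); auto.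
  - rewrite (eval_app Delta _ _ K1 (KArr K2 K3)); auto.
  - econstructor; eauto.
Qed.

(** Both sides are assumed well-kinded because a reduct may fail to be, as with Typerec over a
    record at a kind other than [Type]. *)
Lemma cstep_eval C D :
  cstep C D -> forall Delta K rho, matches Delta (kinds rho) ->
  kinding Delta C K -> kinding Delta D K -> eval C K rho = eval D K rho.
Proof.
  induction 1; intros Delta K0 rho Hrho HC HD;
    try (inversion HC; subst; inversion HD; subst; simpl;
         repeat (f_equal; eauto); fail).
  - apply kinding_app_inv in HC. destruct HC as (K1 & HC & HD').
    inversion HC; subst.
    rewrite (eval_app Delta _ _ K1 K0); auto.
    erewrite eval_inst; eauto. reflexivity.
  - inversion HC; subst.
    change (map_row (eval C (KArr KType KType) rho)
              (ginsert l (eval D KType rho) (eval S KRow rho)) =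
            ginsert l (eval (CApp C D) KType rho)
              (map_row (eval C (KArr KType KType) rho) (eval S KRow rho))).
    rewrite map_row_ginsert, (eval_app Delta _ _ KType KType); auto.
  - inversion HC; subst. erewrite eval_app2; eauto.
    + reflexivity.
    + apply kinding_list_inv; auto.
  - inversion HC as [| | | | | | |? ? ? ? ? ? ? ? HS H4 _ _ _ HR _| | |]; subst.
    apply kinding_row_inv in HS.
    erewrite eval_app2; eauto.
    (* In the reduct, [CRmap] takes a function from types to types, which forces the result kind of
       the Typerec to be [Type]. There [to_type] is the identity. *)
    apply kinding_app_inv in HD. destruct HD as (K1 & _ & HD).
    inversion HD as [| | | | | | | | | |? ? HL _]; subst.
    inversion HL as [| |? ? ? HT| | | | | | | |]; subst.
    inversion HT as [| | | | | | |? ? ? ? ? ? ? ? _ HB _ _ _ _ _| | |]; subst.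
    assert (K0 = KType).
    { rewrite <- (infer_kinding _ _ _ H4 _ Hrho).
      rewrite <- (infer_kinding _ _ _ HB _ (matches_scons _ _ KType Hrho)).
      unfold con_shift. rewrite infer_ren. reflexivity. }
    subst K0. cbn -[con_shift cast]. f_equal. unfold map_row. apply map_ext.
    intros [l g]. cbn -[con_shift cast].
    rewrite !eval_scons_shift, cast_same. reflexivity.
  - inversion HC; subst. erewrite eval_app2; eauto.
    + reflexivity.
    + apply kinding_trace_inv; auto.
  - inversion HC; subst. inversion HD; subst. simpl.
    apply functional_extensionality; intros d.
    eapply IHcstep; eauto. rewrite kinds_scons. apply matches_scons; auto.
  (* Here and in the next case the two kindings might differ in the kind of the argument. The redex
     and the reduct share one of their two parts, and uniqueness of its kind settles the matter. *)
  - apply kinding_app_inv in HC. destruct HC as (K1 & HC & HD1).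
    apply kinding_app_inv in HD. destruct HD as (K2 & HD & HD2).
    rewrite (kinding_unique _ _ _ _ HD2 HD1) in HD.
    rewrite !(eval_app Delta _ _ K1 K0); auto.
    erewrite IHcstep; eauto.
  - apply kinding_app_inv in HC. destruct HC as (K1 & HC & HD1).
    apply kinding_app_inv in HD. destruct HD as (K2 & HD & HD2).
    pose proof (kinding_unique _ _ _ _ HD HC) as E. injection E as ->.
    rewrite !(eval_app Delta _ _ K1 K0); auto.
    erewrite IHcstep; eauto.
Qed.

(** In the model, eta is functional extensionality and the exchange of fields is commutation of
    insertions. *)
Lemma ceq_eval Delta C D K :
  ceq Delta C D K -> forall rho, matches Delta (kinds rho) ->
  eval C K rho = eval D K rho.
Proof.
  induction 1; intros rho Hrho;
    try (simpl; repeat match goal with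
         | IH : forall rho, _ -> eval _ _ rho = _ |- _ =>
             rewrite (IH rho Hrho); clear IH
         end; reflexivity).
  - eapply cstep_eval; eauto.
  - apply functional_extensionality; intros d.
    change (eval (CApp (con_shift C) (CVar 0)) K2 (scons (existT _ K1 d) rho)
            = eval C (KArr K1 K2) rho d).
    rewrite (eval_app (K1 :: Delta) _ _ K1 K2).
    + rewrite eval_scons_shift. apply f_equal. exact (cast_same K1 d).
    + rewrite kinds_scons. apply matches_scons; auto.
    + apply kinding_shift; auto.
  - apply ginsert_comm. inversion H; subst. simpl in *. intuition.
  - simpl. apply functional_extensionality; intros d.
    apply IHceq. rewrite kinds_scons. apply matches_scons; auto.
  - apply ceq_kinding in H. destruct H as [HC HC'].
    rewrite !(eval_app Delta _ _ K1 K2); auto.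
    rewrite IHceq1, IHceq2; auto.
Qed.

(** * Ground values of types *)

(** Arrow and universal types have no tree of their own; giving all of them the same one respects
    equivalence. *)
Fixpoint sem (rho : env) (A : ty) : gty :=
  match A with
  | TT C => eval C KType rho
  | TBase b => GBase b
  | TArr _ _ | TAll _ _ => GBase BBool
  | TList A => GList (sem rho A)
  | TRecord R => GRec (sem_row rho R)
  | TTrace A => GTrace (sem rho A)
  end
with sem_row (rho : env) (R : row) : grow :=
  match R with
  | REmpty => nil
  | RField l A R => ginsert l (sem rho A) (sem_row rho R)
  | RT r => eval r KRow rho
  end.

Lemma teq_sem_mut :
  (forall Delta A B, teq Delta A B -> forall rho,
     matches Delta (kinds rho) -> sem rho A = sem rho B) /\
  (forall Delta R R', req Delta R R' -> forall rho,
     matches Delta (kinds rho) -> sem_row rho R = sem_row rho R').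
Proof.
  apply teq_req_ind; intros; simpl; auto;
    try (f_equal; eauto using ceq_eval; fail).
  - symmetry; auto.
  - rewrite H0 by auto. auto.
  - apply (ceq_eval _ _ _ KType H); auto.
  - symmetry; auto.
  - rewrite H0 by auto. auto.
  - apply ginsert_comm. inversion H; subst. simpl in *. intuition.
  - apply (ceq_eval _ _ _ KRow H); auto.
Qed.

Definition teq_sem Delta A B rho (H : teq Delta A B) :
  matches Delta (kinds rho) -> sem rho A = sem rho B :=
  proj1 teq_sem_mut Delta A B H rho.

(** * Reification of values as ground constructors *)

Definition labels (r : grow) : list label := map fst r.

Lemma labels_ginsert l g r :
  Permutation (labels (ginsert l g r)) (l :: labels r).
Proof. apply (Permutation_map fst (ginsert_perm l g r)). Qed.

Lemma in_labels_ginsert x l g r :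
  In x (labels (ginsert l g r)) <-> l = x \/ In x (labels r).
Proof.
  split; intros H.
  - apply (Permutation_in _ (labels_ginsert l g r)) in H. exact H.
  - apply (Permutation_in _ (Permutation_sym (labels_ginsert l g r))). exact H.
Qed.

(* The value of a well-kinded row may repeat a label, as in
   [(\rho. (l : C; rho)) (l : D; .)], so that reification has to drop the
   fields that are repeated. *)
Definition add_field (l : label) (C R : con) : con :=
  if in_dec string_dec l (con_labels R) then R else CField l C R.

Fixpoint reify (g : gty) : con :=
  match g with
  | GBase b => CBase b
  | GList g => CList (reify g)
  | GRec r =>
      CRecord (fold_right (fun f => add_field (fst f) (reify (snd f))) CEmpty r)
  | GTrace g => CTrace (reify g)
  end.

Definition reify_row (r : grow) : con :=
  fold_right (fun f => add_field (fst f) (reify (snd f))) CEmpty r.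

Lemma reify_rec r : reify (GRec r) = CRecord (reify_row r).
Proof. reflexivity. Qed.

Lemma in_labels_reify x r : In x (con_labels (reify_row r)) <-> In x (labels r).
Proof.
  induction r as [|[l g] r IH]; simpl; [tauto|]. unfold add_field at 1.
  destruct in_dec as [Hin|Hin]; simpl.
  - rewrite <- IH. split; auto. intros [<-|H]; auto.
  - rewrite <- IH. tauto.
Qed.

Lemma ground_reify g : ground (reify g).
Proof.
  induction g using gty_ind_nested; simpl; constructor; auto.
  induction H as [|[l g] r Hg _ IH]; simpl; [constructor|].
  unfold add_field at 1. destruct in_dec; auto. constructor; auto.
Qed.

Lemma kinding_reify Delta g : kinding Delta (reify g) KType.
Proof.
  induction g using gty_ind_nested; simpl; constructor; auto.
  induction H as [|[l g] r Hg _ IH]; simpl; [constructor|].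
  unfold add_field at 1. destruct in_dec; auto. constructor; auto.
Qed.

Lemma kinding_reify_row Delta r : kinding Delta (reify_row r) KRow.
Proof. apply kinding_row_inv. exact (kinding_reify Delta (GRec r)). Qed.

Lemma kinding_reify_field Delta l g r :
  ~ In l (labels r) -> kinding Delta (CField l (reify g) (reify_row r)) KRow.
Proof.
  intros H. constructor; auto using kinding_reify, kinding_reify_row.
  rewrite in_labels_reify; auto.
Qed.

(** Since [l] is fresh, its insertion does not change which fields of [r] are dropped as repeated.
    The kept fields that precede it in the sorted order are swapped past it one at a time. *)
Lemma reify_ginsert Delta l g r :
  ~ In l (labels r) ->
  ceq Delta (reify_row (ginsert l g r)) (CField l (reify g) (reify_row r)) KRow.
Proof.
  induction r as [|[l' g'] r IH]; intros H.
  - apply ce_refl, (kinding_reify_field _ _ _ nil); auto.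
  - simpl ginsert. destruct (String.leb l l') eqn:E.
    + change (ceq Delta
        (add_field l (reify g) (reify_row ((l', g') :: r)))
        (CField l (reify g) (reify_row ((l', g') :: r))) KRow).
      unfold add_field at 1. destruct in_dec as [Hin|_].
      * rewrite in_labels_reify in Hin. contradiction.
      * apply ce_refl, kinding_reify_field; auto.
    + simpl in H. assert (Hr : ~ In l (labels r)) by tauto.
      specialize (IH Hr).
      change (ceq Delta
        (add_field l' (reify g') (reify_row (ginsert l g r)))
        (CField l (reify g) (add_field l' (reify g') (reify_row r))) KRow).
      unfold add_field.
      destruct in_dec as [H1|H1]; destruct in_dec as [H2|H2];
        rewrite in_labels_reify in H1, H2;
        rewrite in_labels_ginsert in H1.
      * exact IH.
      * exfalso. intuition congruence.
      * exfalso. intuition.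
      * eapply ce_trans.
        -- apply ce_field with (S' := CField l (reify g) (reify_row r));
             [apply ce_refl, kinding_reify|exact IH| |].
           ++ rewrite in_labels_reify, in_labels_ginsert; auto.
           ++ simpl. rewrite in_labels_reify; auto.
        -- apply ce_swap. constructor; auto using kinding_reify.
           ++ apply kinding_reify_field; auto.
           ++ simpl. rewrite in_labels_reify; auto.
Qed.

Scheme ground_min := Minimality for ground Sort Prop
with ground_row_min := Minimality for ground_row Sort Prop.
Combined Scheme ground_both_ind from ground_min, ground_row_min.

(** Evaluation sorts the fields of a row, so its labels are preserved up to permutation. This
    carries the freshness given by kinding over to the value, where [reify_ginsert] asks for it. *)
Lemma reify_ground_mut Delta rho :
  (forall F, ground F -> kinding Delta F KType ->
     ceq Delta (reify (eval F KType rho)) F KType) /\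
  (forall S, ground_row S -> kinding Delta S KRow ->
     Permutation (labels (eval S KRow rho)) (con_labels S) /\
     ceq Delta (reify_row (eval S KRow rho)) S KRow).
Proof.
  apply ground_both_ind; simpl; intros.
  - apply ce_refl; constructor.
  - apply ce_list. inversion H1; auto.
  - apply ce_record. inversion H1; subst. apply H0; auto.
  - apply ce_trace. inversion H1; auto.
  - split; auto. apply ce_refl; constructor.
  - apply kinding_field_inv in H3. destruct H3 as (HF & HS & Hnin).
    destruct (H2 HS) as [HP HE]. split.
    + rewrite labels_ginsert. auto.
    + assert (Hl : ~ In l (labels (eval S KRow rho))).
      { intros Hin. apply Hnin. eapply Permutation_in; eauto. }
      eapply ce_trans; [apply reify_ginsert; auto|].
      apply ce_field; auto. rewrite in_labels_reify; auto.
Qed.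

Lemma reify_ground Delta rho F :
  ground F -> kinding Delta F KType ->
  ceq Delta (reify (eval F KType rho)) F KType.
Proof. apply reify_ground_mut. Qed.

Lemma kinding_row_NoDup Delta S :
  ground_row S -> kinding Delta S KRow -> NoDup (con_labels S).
Proof.
  induction 1; simpl; intros HK; constructor;
    apply kinding_field_inv in HK; intuition.
Qed.

(** * Existence of the transformation *)

(** One computed form must serve all [k] and [t], as [dist] changes them on its way down. Equality
    of labels transfers freshness from [S] to the computed row. *)
Lemma dist_total_mut Delta :
  (forall F, ground F -> kinding Delta F KType ->
     exists T, ceq Delta (CApp TRACE F) T KType /\
               forall k t, exists P, dist T k t = Some P) /\
  (forall S, ground_row S -> kinding Delta S KRow ->
     exists T, ceq Delta (CRmap TRACE S) T KRow /\
               con_labels T = con_labels S /\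
               forall k t, exists P, dist T k t = Some P).
Proof.
  apply ground_both_ind.
  - intros b _. exists (CTrace (CBase b)). split; [apply TRACE_base|].
    simpl; eauto.
  - intros F _ IH HK. apply kinding_list_inv in HK.
    destruct (IH HK) as (T & HT & Hd).
    exists (CList T). split.
    + eapply ce_trans; [apply TRACE_list; auto|]. apply ce_list; auto.
    + intros k t. destruct (Hd (hole_shift k) (Var 0)) as [P HP].
      simpl. rewrite HP. eauto.
  - intros S _ IH HK. apply kinding_row_inv in HK.
    destruct (IH HK) as (T & HT & _ & Hd).
    exists (CRecord T). split; [|exact Hd].
    eapply ce_trans; [apply TRACE_record; auto|]. apply ce_record; auto.
  - intros F _ IH HK. apply kinding_trace_inv in HK.
    destruct (IH HK) as (T & HT & Hd). exists T. split; [|exact Hd].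
    eapply ce_trans; [apply TRACE_trace; auto|]. auto.
  - intros _. exists CEmpty. split; [apply rmap_TRACE_empty|]. simpl; eauto.
  - intros l F S _ IHF _ IHS HK.
    pose proof (kinding_field_inv _ _ _ _ _ HK) as (H2 & H3 & H4).
    destruct (IHF H2) as (T1 & HT1 & Hd1).
    destruct (IHS H3) as (T2 & HT2 & Hl & Hd2).
    exists (CField l T1 T2). split; [|split].
    + eapply ce_trans; [apply rmap_TRACE_field; auto|].
      apply ce_field; auto. rewrite Hl; auto.
    + simpl; congruence.
    + intros k t. simpl. destruct (Hd1 k (Proj t l)) as [P ->].
      destruct (Hd2 k t) as [Q ->]. eauto.
Qed.

Lemma dist_at_total Delta F k t :
  ground F -> kinding Delta F KType ->
  exists P, dist_at Delta (CApp TRACE F) k t P.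
Proof.
  intros HF HK.
  destruct (proj1 (dist_total_mut Delta) F HF HK) as (T & HT & Hd).
  destruct (Hd k t) as [P HP]. exists P, T. auto.
Qed.

Lemma ground_base_con_row fs : ground_row (base_con_row fs).
Proof. induction fs; simpl; repeat constructor; auto. Qed.

(** Open types need a ground value too, so each type variable takes the default of its kind. By
    [reify_ground], a ground constructor is recovered from its value in any environment. *)
Definition default_env (Delta : list kind) : env :=
  fun n => match nth_error Delta n with
           | Some K => existT _ K (default K)
           | None => existT _ KType (default KType)
           end.

Lemma matches_default Delta : matches Delta (kinds (default_env Delta)).
Proof.
  intros n K E. unfold kinds, default_env. rewrite E. reflexivity.
Qed.

(* Under [for], typing fixes the type of the bound variable only up to its
   value.  The context of the typing derivation is on the left, that of the
   transformation on the right. *)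
Definition ground_ctx (Delta : list kind) : list ty -> list ty -> Prop :=
  Forall2 (fun A A' =>
    sem (default_env Delta) A = sem (default_env Delta) A' /\
    exists F, ground F /\ teq Delta A' (TT F)).

Lemma ground_ctx_nth Delta G G' x A :
  ground_ctx Delta G G' -> nth_error G x = Some A ->
  exists A' F, nth_error G' x = Some A' /\ ground F /\ teq Delta A' (TT F) /\
    sem (default_env Delta) A = eval F KType (default_env Delta).
Proof.
  intros H. revert x. induction H as [|A1 A2 G G' (HS & F & HF & HE) _ IH];
    intros [|x] Hx; simpl in *; try discriminate; eauto.
  injection Hx as <-. exists A2, F. repeat split; auto.
  rewrite HS. exact (teq_sem _ _ _ _ HE (matches_default _)).
Qed.

Lemma typed_var_inv Delta G x A :
  typed Delta G (Var x) A -> exists A0, nth_error G x = Some A0 /\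
    sem (default_env Delta) A = sem (default_env Delta) A0.
Proof.
  remember (Var x) as M eqn:E. intros H. revert E.
  induction H; intros E; try discriminate.
  - injection E as ->. eauto.
  - destruct (IHtyped E) as (A0 & HA0 & HS). exists A0. split; auto.
    rewrite (teq_sem _ _ _ _ H0); auto using matches_default.
Qed.

Lemma typed_table_inv Delta G n R A :
  typed Delta G (Table n R) A -> NoDup (map fst (table_fields R)) /\
    sem (default_env Delta) A =
    sem (default_env Delta) (TList (TRecord (base_row (table_fields R)))).
Proof.
  remember (Table n R) as M eqn:E. intros H. revert E.
  induction H; intros E; try discriminate.
  - injection E as -> ->. auto.
  - destruct (IHtyped E) as [HN HS]. split; auto.
    rewrite (teq_sem _ _ _ _ H0); auto using matches_default.
Qed.

(** Well-formedness of a row only compares visible labels, while its value may have more. For a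
    record literal the syntax bounds the labels of the value, which gives the freshness needed to
    extend it. *)
Lemma typed_fields_labels Delta G M A ls :
  typed Delta G M A -> plain_fields ls M ->
  exists r, sem (default_env Delta) A = GRec r /\ incl (labels r) ls.
Proof.
  intros H. revert ls. induction H; intros ls HP; try (inversion HP; fail).
  - exists nil. split; auto. intros x [].
  - inversion HP as [|? ls' ? ? _ _ HN]; subst.
    destruct (IHtyped2 _ HN) as (r & Hr & Hl). injection Hr as <-.
    eexists; split; [reflexivity|].
    intros x Hx. apply in_labels_ginsert in Hx. simpl. destruct Hx; auto.
  - destruct (IHtyped _ HP) as (r & Hr & Hl). exists r. split; auto.
    rewrite (teq_sem _ _ _ _ H0); auto using matches_default.
Qed.

Lemma plain_recext_inv l M N :
  plain (RecExt l M N) ->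
  exists ls, ~ In l ls /\ plain M /\ plain_fields ls N.
Proof.
  inversion 1 as [| | |? ? HF| | | | | | | |]; subst.
  inversion HF; subst; eauto.
Qed.

Lemma plain_of_cond L : plain_cond L -> plain L.
Proof. destruct 1; constructor; auto. Qed.

(** [p_record] concludes [plain M] for any [M], so inversion leaves a case in which [plain_fields]
    has to be inverted as well. *)
Ltac not_plain :=
  match goal with
  | HP : plain _ |- _ =>
      solve [inversion HP; match goal with
             | HF : plain_fields _ _ |- _ => inversion HF
             end]
  end.

(** The constructor is a function of [A], so premises of a typing rule that share a type yield
    transformations at the same constructor. Conversion preserves the value and thus the
    constructor. *)
Lemma trans_exists Delta G M A :
  typed Delta G M A -> forall G', plain M -> ground_ctx Delta G G' ->
  exists M', trans Delta G' M (reify (sem (default_env Delta) A)) M'.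
Proof.
  intros H. induction H; intros G' HP HG; try not_plain.
  - destruct (ground_ctx_nth _ _ _ _ _ HG H) as (A' & F & Hx & HF & HE & HS).
    exists (Var x). eapply tr_var; [exact Hx|].
    eapply te_trans; [exact HE|]. rewrite HS. apply te_T, ce_sym, reify_ground;
      eauto using teq_kinding.
  - eexists. apply tr_const.
  - inversion HP as [| | |? ? HF| | |? ? ? HL HM HN| | | | |];
      [inversion HF|subst].
    destruct (IHtyped1 G' (plain_of_cond _ HL) HG) as [L' HL'].
    destruct (IHtyped2 G' HM HG) as [M' HM'].
    destruct (IHtyped3 G' HN HG) as [N' HN'].
    set (F := reify (sem (default_env Delta) A)) in *.
    destruct (dist_at_total Delta F (HIf L') M') as [P HPd];
      [apply ground_reify|apply kinding_reify|].
    destruct (dist_at_total Delta F (HIf L') N') as [Q HQd];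
      [apply ground_reify|apply kinding_reify|].
    eexists. eapply tr_if; eauto.
  - inversion HP as [| | |? ? HF|? ? HM HN| | | | | | |];
      [inversion HF|subst].
    destruct (IHtyped1 G' HM HG) as [M' HM'].
    destruct (IHtyped2 G' HN HG) as [N' HN'].
    eexists. apply tr_plus; eauto.
  - inversion HP as [| | |? ? HF| |? ? HM HN| | | | | |];
      [inversion HF|subst].
    destruct (IHtyped1 G' HM HG) as [M' HM'].
    destruct (IHtyped2 G' HN HG) as [N' HN'].
    eexists. eapply tr_eq; eauto.
  - eexists. apply tr_recnil.
  - destruct (plain_recext_inv _ _ _ HP) as (ls & Hl & HM & HN).
    destruct (IHtyped1 G' HM HG) as [M' HM'].
    destruct (IHtyped2 G' (p_record _ _ HN) HG) as [N' HN'].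
    destruct (typed_fields_labels _ _ _ _ _ H0 HN) as (r & Hr & Hincl).
    injection Hr as Hr.
    assert (Hlr : ~ In l (labels r)) by auto.
    simpl sem in *. rewrite Hr in *. rewrite reify_rec in *.
    (* The literal has its new field in front, the value of its type has it in sorted position;
       [reify_ginsert] relates the two. *)
    eexists. eapply tr_conv.
    + eapply tr_recext; [exact HM'|exact HN'|].
      apply kinding_reify_field; auto.
    + apply ce_record, ce_sym, reify_ginsert; auto.
  - inversion HP as [| |? ? |? ? HF| | | | | | | |]; [subst|inversion HF].
    destruct (typed_var_inv _ _ _ _ H) as (A0 & Hx & HS).
    destruct (ground_ctx_nth _ _ _ _ _ HG Hx) as (A' & F & Hx' & HF & HE & HS').
    pose proof (teq_kinding _ _ _ HE) as HK.
    set (rho := default_env Delta) in *.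
    (* The row in the typing could hide a second field [l]. It has the same value as the ground and
       well-kinded [F], whose labels are distinct, so [l] occurs once and reification keeps the
       field of type [A]. *)
    assert (Hr : exists r, sem_row rho (RField l A R) = r /\ NoDup (labels r) /\
      reify (eval F KType rho) = CRecord (reify_row r)).
    { eexists; split; [reflexivity|]. rewrite <- HS', <- HS. split; [|reflexivity].
      rewrite <- HS in HS'. destruct HF; try discriminate HS'.
      apply kinding_row_inv in HK. injection HS' as HS'. simpl. rewrite HS'.
      eapply Permutation_NoDup.
      - apply Permutation_sym. eapply reify_ground_mut; eauto.
      - eapply kinding_row_NoDup; eauto. }
    destruct Hr as (r & Hr & Hnd & HrF). simpl in Hr. subst r.
    assert (Hl : ~ In l (labels (sem_row rho R))).
    { apply (Permutation_NoDup (labels_ginsert _ _ _)) in Hnd.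
      inversion Hnd; auto. }
    eexists. eapply tr_proj. eapply tr_var; [exact Hx'|].
    eapply te_trans; [exact HE|]. apply te_T.
    eapply ce_trans; [apply ce_sym, (reify_ground _ rho); auto|].
    rewrite HrF. apply ce_record, reify_ginsert; auto.
  - eexists. apply tr_nil, kinding_reify.
  - inversion HP as [| | |? ? HF| | | | |? HM| | |]; [inversion HF|subst].
    destruct (IHtyped G' HM HG) as [M' HM'].
    eexists. apply tr_single; eauto.
  - inversion HP as [| | |? ? HF| | | | | |? ? HM HN| |]; [inversion HF|subst].
    destruct (IHtyped1 G' HM HG) as [M' HM'].
    destruct (IHtyped2 G' HN HG) as [N' HN'].
    eexists. apply tr_append; eauto.
  - inversion HP as [| | |? ? HF| | | | | | |n R0 ? HN|]; [inversion HF|subst].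
    destruct (typed_table_inv _ _ _ _ _ H) as [Hnd HS].
    (* The transformation binds the loop variable at the row type of the table. The type that the
       typing derivation gives it is only known to have the same value. *)
    set (D := CRecord (base_con_row (table_fields R0))).
    pose proof (teq_base_record Delta _ Hnd) as HD.
    injection HS as HS.
    destruct (IHtyped2 (TT D :: G') HN) as [N' HN'].
    { constructor; auto. split.
      - rewrite <- (teq_sem _ _ _ _ HD); auto using matches_default.
      - exists D. split.
        + constructor. apply ground_base_con_row.
        + apply te_refl, wf_TT. eapply teq_kinding; eauto. }
    simpl sem in *. simpl reify in *.
    destruct (dist_at_total Delta (CList (reify (sem (default_env Delta) B)))
      (HFor D (Var 0)) N') as [P HPd].
    { constructor. apply ground_reify. }
    { constructor. apply kinding_reify. }
    eexists. eapply tr_for; [apply tr_table; auto|exact HN'|exact HPd].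
  - eexists. eapply tr_conv; [apply tr_table; auto|].
    pose proof (teq_base_record Delta _ H) as HD.
    pose proof (teq_sem _ _ _ _ HD (matches_default Delta)) as HS.
    change (ceq Delta (CList (CRecord (base_con_row (table_fields R))))
      (CList (reify (sem (default_env Delta)
         (TRecord (base_row (table_fields R)))))) KType).
    rewrite HS. apply ce_list, ce_sym. apply reify_ground.
    + constructor. apply ground_base_con_row.
    + eapply teq_kinding; eauto.
  - destruct (IHtyped G' HP HG) as [M' HM'].
    rewrite (teq_sem _ _ _ _ H0); eauto using matches_default.
Qed.

(** As [trans] is a relation, typing of its results could hold for want of results; the second claim
    provides one at every constructor equivalent to a ground one. *)
Theorem theorem11 :
  forall (Delta : list kind) (G G' : list ty) (M : tm) (A : ty),
    Forall base_record G ->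
    trace_ctx G G' ->
    plain M ->
    typed Delta G M A ->
    forall C : con,
      teq Delta A (TT C) ->
      (forall M', trans Delta G M C M' ->
                  typed Delta G' M' (TT (CApp TRACE C))) /\
      (forall F, ground F -> ceq Delta C F KType ->
                 exists M', trans Delta G M C M').
Proof.
  intros Delta G G' M A HG HG' HM HA C HC. split.
  - intros M' Ht. eapply trans_typed; eauto.
    clear - HG'. induction HG' as [|B B' G G' (D & HD & ->)];
      constructor; eauto using teq_weaken.
  (* Both contexts of [ground_ctx] start as [G], whose types are closed base records and hence
     ground. *)
  - intros F HF HE. destruct (trans_exists _ _ _ _ HA G HM) as [M' HM'].
    + clear - HG. induction HG as [|B G (fs & Hfs & HB) _ IH]; constructor; auto.
      split; auto. exists (CRecord (base_con_row fs)). split.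
      * constructor. apply ground_base_con_row.
      * eapply te_trans; [apply teq_weaken; eauto|].
        apply teq_base_record; auto.
    (* The types [A], [TT C] and [TT F] share one value, and its reification is equivalent to [F],
       hence to [C]. *)
    + exists M'. eapply tr_conv; [exact HM'|].
      rewrite (teq_sem _ _ _ _ HC) by apply matches_default. simpl sem.
      pose proof (proj2 (ceq_kinding _ _ _ _ HE)) as HK.
      pose proof (ceq_eval _ _ _ _ HE _ (matches_default Delta)) as HV.
      simpl in HV. rewrite HV. eapply ce_trans; [apply reify_ground; auto|].
      apply ce_sym; auto.
Qed.
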